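(* Suppose the random vector $X_1\in\mathbb R^p$ follows a Marčenko–Pastur model with a positive definite covariance matrix $\Sigma$; that is, $X_1=MZ_1$, where $M\in\mathbb S^{p\times p}$ is non-random and positive semidefinite, and $Z_1\in\mathbb R^p$ is a random vector with i.i.d. entries satisfying $\mathbf E(Z_{11})=0$ and $\mathrm{var}(Z_{11})=1$ (where $Z_{11}$ is the first entry of $Z_1$). Let $\Sigma=\sum_{j=1}^p\lambda_j(\Sigma)\phi_j\phi_j^\top$ be the spectral decomposition with $\lambda_1(\Sigma)\ge\cdots\ge\lambda_p(\Sigma)$ and orthonormal $\phi_1,\dots,\phi_p$, and let $\zeta_{1j}=\langle X_1,\phi_j\rangle/\|\langle X_1,\phi_j\rangle\|_{L^2}$. Then: (1) If $\sup_{q\ge2}q^{-\nu}\|Z_{11}\|_{L^q}\lesssim1$ for some constant $\nu>0$ not depending on $n$, then there is a parameter $\nu'>0$, fixed with respect to $n$, such that $\sup_{1\le j\le p}\sup_{q\ge2}q^{-\nu'}\|\zeta_{1j}\|_{L^q}\lesssim1$. (2) If $\mathrm{var}(Z_{11}^2)\asymp1$, then $$1\lesssim\inf_{1\le d\le p}\lambda_{\min}(\mathsf J_d)\le\sup_{1\le d\le p}\lambda_{\max}(\mathsf J_d)\lesssim1,$$ where $\mathsf J_d:\mathbb S^{d\times d}\to\mathbb S^{d\times d}$ is the covariance operator of the random matrix $(\zeta_{11},\dots,\zeta_{1d})(\zeta_{11},\dots,\zeta_{1d})^\top$.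
   Context: The models form a sequence indexed by $n$; the dimension $p$, the matrix $M$ and the distribution of $Z_1$ may all vary with $n$, and the size of $p$ relative to $n$ is unconstrained. For sequences of non-negative numbers, $a_n\lesssim b_n$ means that there is a constant $c>0$ not depending on $n$ (hence not on $p$) such that $a_n\le c\,b_n$ for all large $n$; $a_n\asymp b_n$ means $a_n\lesssim b_n$ and $b_n\lesssim a_n$. $\|U\|_{L^q}=(\mathbf E|U|^q)^{1/q}$. $\mathbb S^{d\times d}$ is the Hilbert space of real symmetric $d\times d$ matrices with inner product $\langle\!\langle A,B\rangle\!\rangle=\mathrm{tr}(AB)$. The covariance operator of a random element $W$ of $\mathbb S^{d\times d}$ is the linear operator $\mathsf K$ on $\mathbb S^{d\times d}$ satisfying $\langle\!\langle A,\mathsf K(B)\rangle\!\rangle=\mathrm{cov}(\langle\!\langle A,W\rangle\!\rangle,\langle\!\langle B,W\rangle\!\rangle)$ for all $A,B$; $\lambda_{\min},\lambda_{\max}$ denote its smallest and largest eigenvalues. Vectors written $(\zeta_{11},\dots,\zeta_{1d})$ are column vectors. *)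

(* Defs.v *)
From HB Require Import structures.
From mathcomp Require Import all_boot all_order all_algebra.
From mathcomp Require Import all_classical all_reals all_analysis.

Set Implicit Arguments.
Unset Strict Implicit.
Unset Printing Implicit Defensive.

Import Order.TTheory GRing.Theory Num.Theory.
Import numFieldNormedType.Exports.

Local Open Scope classical_set_scope.
Local Open Scope ring_scope.

Section asymptotics.
Context {R : realType}.

Definition lesssim (a b : nat -> \bar R) : Prop :=
  exists2 c : R, 0 < c & \forall n \near \oo, (a n <= c%:E * b n)%E.

Definition asymp (a b : nat -> \bar R) : Prop := lesssim a b /\ lesssim b a.

End asymptotics.

Section linear_algebra.
Context {R : realType}.

Definition dotp p (u v : 'cV[R]_p) : R := (u^T *m v) 0 0.

Definition psdmx p (A : 'M[R]_p) : Prop :=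
  A^T = A /\ forall v : 'cV[R]_p, 0 <= dotp v (A *m v).

Definition pdmx p (A : 'M[R]_p) : Prop :=
  A^T = A /\ forall v : 'cV[R]_p, v != 0 -> 0 < dotp v (A *m v).

Definition spectral_decomposition p (A : 'M[R]_p)
    (lam : 'I_p -> R) (phi : 'I_p -> 'cV[R]_p) : Prop :=
  [/\ A = \sum_(j < p) lam j *: (phi j *m (phi j)^T),
      forall i j : 'I_p, (i <= j)%N -> lam j <= lam i &
      forall i j : 'I_p, dotp (phi i) (phi j) = (i == j)%:R].

Definition sym_space d : {vspace 'M[R]_d} :=
  fixedSpace (linfun (@trmx R d d)).

Lemma mem_sym_space d (A : 'M[R]_d) : (A \in sym_space d) = (A^T == A).
Proof.
by apply/fixedSpaceP/eqP; rewrite lfunE.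
Qed.

Definition sym d := subvs_of (sym_space d).

Definition sym_dot d (A B : sym d) : R := \tr (vsval A *m vsval B).

Lemma outer_sym_subproof d (v : 'cV[R]_d) : v *m v^T \in sym_space d.
Proof. by rewrite mem_sym_space trmx_mul trmxK. Qed.

Definition outer_sym d (v : 'cV[R]_d) : sym d := Subvs (outer_sym_subproof v).

(* For a self-adjoint operator on a nonzero finite-dimensional space, the set
   of eigenvalues is finite and nonempty, so that inf and sup are attained. *)
Definition lambda_min (V : vectType R) (K : 'End(V)) : R :=
  inf [set a : R | passmx.leigenvalue K a].

Definition lambda_max (V : vectType R) (K : 'End(V)) : R :=
  sup [set a : R | passmx.leigenvalue K a].

End linear_algebra.

Arguments sym : clear implicits.

Section probability.
Context d (T : measurableType d) {R : realType} (P : probability T R).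

(* The L^q norm, as an extended real: it is +oo when E|U|^q is infinite. *)
Definition Lq_norm (q : R) (U : T -> R) : \bar R := 'N[P]_(q%:E)[EFin \o U]%E.

Definition Lq_growth (nu : R) (U : T -> R) : \bar R :=
  ereal_sup [set ((q `^ (- nu))%:E * Lq_norm q U)%E | q in [set q : R | 2 <= q]].

Definition mutually_independent (I : finType) (X : I -> T -> R) : Prop :=
  forall (J : {set I}) (A : I -> set R), (forall i, measurable (A i)) ->
    P (\bigcap_(i in [set` J]) (X i @^-1` A i)) =
    (\prod_(i in J) P (X i @^-1` A i))%E.

Definition identically_distributed (I : Type) (X : I -> {RV P >-> R}) : Prop :=
  forall (i j : I) (A : set R), measurable A ->
    distribution P (X i) A = distribution P (X j) A.

Definition covariance_matrix p (X : T -> 'cV[R]_p) : 'M[R]_p :=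
  \matrix_(i, j) fine (covariance P (fun w => X w i 0) (fun w => X w j 0)).

Definition is_covariance_operator k (W : T -> sym R k) (K : 'End(sym R k)) :=
  forall A B : sym R k,
    (sym_dot A (K B))%:E =
    covariance P (fun w => sym_dot A (W w)) (fun w => sym_dot B (W w)).

(* The operator characterized by is_covariance_operator, which determines it
   uniquely; it exists when the entries of W are square-integrable, and the
   value is the junk operator 0 when no such operator exists. *)
Definition covariance_operator k (W : T -> sym R k) : 'End(sym R k) :=
  xget 0 [set K | is_covariance_operator W K].

Definition MP_vector p (M : 'M[R]_p) (Z : 'I_p -> T -> R) (w : T) : 'cV[R]_p :=
  M *m (\col_i Z i w).

Definition normalized_score p (X : T -> 'cV[R]_p) (phi : 'I_p -> 'cV[R]_p)
    (j : 'I_p) (w : T) : R :=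
  dotp (X w) (phi j) / fine (Lq_norm 2 (fun w' => dotp (X w') (phi j))).

Definition leading_scores p (zeta : 'I_p -> T -> R) (d' : 'I_p) (w : T) :
    'cV[R]_d'.+1 :=
  \col_(i < d'.+1) zeta (widen_ord (ltn_ord d') i) w.

(* The dimensions d with 1 <= d <= p are represented as d = d'.+1, d' : 'I_p. *)
Definition score_operator p (zeta : 'I_p -> T -> R) (d' : 'I_p) :
    'End(sym R d'.+1) :=
  covariance_operator (fun w => outer_sym (leading_scores zeta d' w)).

End probability.

(* Main.v *)
Require Import Defs.
From HB Require Import structures.
From mathcomp Require Import all_boot all_order all_algebra.
From mathcomp Require Import all_classical all_reals all_analysis.
From mathcomp Require Import measurable_realfun complex polyrcf ring lra.

(** The scores are orthonormal linear forms in the entries of Z. Indeed Z has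
    identity covariance, so Sigma = M M^T; hence the vectors
    u_j = M^T phi_j / sqrt(lam_j) are orthonormal, the L^2 norm of
    <X, phi_j> = <Z, M^T phi_j> is sqrt(lam_j), and zeta_j = <Z, u_j>
    ([normalized_score_orthonormal]). Both claims then concern such forms and
    depend on the dimension only through the orthonormality of the u_j.

    Moments. For a sum S of independent centred terms, the elementary inequality
      (a + b)^(2l) <= 2l a^(2l-1) b + (a^2 + K b^2)^l    with K >= 8 l + 1
    ([exprD_even_le]) allows one summand at a time to be added: the first term
    has zero mean, and the binomial expansion of the second one adds up the
    variances. By induction, if E Z_i^(2l) <= mu^l for all l <= k, then
    E (sum_i u_i Z_i)^(2l) <= (K mu sum_i u_i^2)^l
    ([even_moment_sum_le]). With mu of order k^(2 nu) and K of order k, the L^q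
    norm of a unit linear form is at most a constant times q^(nu + 1/2)
    ([Lq_growth_linear_form]).

    Spectrum. The inner product of A with zeta zeta^T is the quadratic form of
    B = U^T A U in Z, where the rows of U are the first u_j. The fourth moments of
    Z give, with v = var(Z_11^2),
      cov(Z^T B Z, Z^T B' Z) = 2 <B, B'> + (v - 2) sum_i B_ii B'_ii
    ([quad_covariance]). Orthonormality gives |B| = |A|, and the sum of the B_ii^2
    lies between 0 and |B|^2; so every eigenvalue of the covariance operator lies
    between min(2, v) and max(2, v) ([covariance_operator_eigenvalue]).
    As inf and sup of the empty set are conventional values, one also
    needs that a self-adjoint operator has an eigenvalue; it comes from a complex
    root of the characteristic polynomial ([selfadjoint_leigenvalue]).

    Independence enters through a single principle: a function determined by
    the Z_i with i in J is independent of Z_k when k is not in J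
    ([determined_by_indep]), and expectations of products of independent
    integrable functions factor ([expectation_indep_pairM]). *)

Set Implicit Arguments.
Unset Strict Implicit.
Unset Printing Implicit Defensive.

Import Order.TTheory GRing.Theory Num.Theory.
Import numFieldNormedType.Exports.

Local Open Scope classical_set_scope.
Local Open Scope ring_scope.

(** * Expectations of products of independent functions *)

Section independent_pair.
Context d (T : measurableType d) (R : realType) (P : probability T R).

Definition indep_pair d1 d2 (T1 : measurableType d1) (T2 : measurableType d2)
    (f : T -> T1) (g : T -> T2) := forall A B,
  measurable A -> measurable B ->
  P (f @^-1` A `&` g @^-1` B) = (P (f @^-1` A) * P (g @^-1` B))%E.

Local Open Scope ereal_scope.

Section joint_law.
Context d1 d2 (T1 : measurableType d1) (T2 : measurableType d2).

(** Independence says that the joint law agrees with the product of the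
    marginal laws on rectangles, hence everywhere; then Tonelli applies. *)
Lemma ge0_integral_indep_pair (f : {mfun T >-> T1}) (g : {mfun T >-> T2})
    (h : T1 * T2 -> \bar R) :
    indep_pair f g -> measurable_fun setT h -> (forall z, 0 <= h z) ->
  \int[P]_w h (f w, g w) =
  \int[distribution P f]_x \int[distribution P g]_y h (x, y).
Proof.
move=> fg mh h0.
have mfg : measurable_fun setT (fun w => (f w, g w)).
  by apply/measurable_fun_pairP; split; exact: measurable_funPT.
pose X : {mfun T >-> (T1 * T2)%type} := mfun_Sub (mem_set mfg).
transitivity (\int[distribution P f \x distribution P g]_z h z); last first.
  exact: fubini_tonelli1.
rewrite (eq_measure_integral (distribution P X)).
  by rewrite ge0_integral_distribution.
move=> A mA _; apply: product_measure_unique => // B C mB mC.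
Qed.

Lemma ge0_integral_indep_pairM (f : {mfun T >-> T1}) (g : {mfun T >-> T2})
    (a : T1 -> \bar R) (b : T2 -> \bar R) :
    indep_pair f g -> measurable_fun setT a -> measurable_fun setT b ->
    (forall x, 0 <= a x) -> (forall y, 0 <= b y) ->
  \int[P]_w (a (f w) * b (g w)) =
  \int[P]_w a (f w) * \int[P]_w b (g w).
Proof.
move=> fg ma mb a0 b0.
rewrite (@ge0_integral_indep_pair f g (fun z => a z.1 * b z.2) fg)/=; last 2 first.
- apply: emeasurable_funM.
    by apply: measurableT_comp; [exact: ma|exact: measurable_fst].
  by apply: measurableT_comp; [exact: mb|exact: measurable_snd].
- by move=> z; exact: mule_ge0.
under eq_integral do rewrite ge0_integralZl//.
rewrite ge0_integralZr ?integral_ge0// !ge0_integral_distribution//.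
Qed.

Local Notation L1 f := (P.-integrable setT (EFin \o f)).
Local Notation "\E f" := (\int[P]_w f w)%R (at level 10, f at level 9).

Lemma integrable_indep_pairM (f : {mfun T >-> T1}) (g : {mfun T >-> T2})
    (a : T1 -> R) (b : T2 -> R) :
    indep_pair f g -> measurable_fun setT a -> measurable_fun setT b ->
    L1 (a \o f) -> L1 (b \o g) -> L1 (fun w => a (f w) * b (g w))%R.
Proof.
move=> fg ma mb /integrableP[_ af] /integrableP[_ bg]; apply/integrableP; split.
  apply/measurable_EFinP; apply: measurable_funM.
    exact: measurableT_comp.
  exact: measurableT_comp.
under eq_integral do rewrite /= normrM EFinM.
rewrite (@ge0_integral_indep_pairM f g (fun x => `|a x|%:E) (fun y => `|b y|%:E))//.
- by rewrite lte_mul_pinfty// ?ge0_fin_numE// ?integral_ge0//.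
- by apply/measurable_EFinP; exact: measurableT_comp.
- by apply/measurable_EFinP; exact: measurableT_comp.
Qed.

Let maxr0_split (t : R) : (t = Num.max t 0 - Num.max (- t) 0)%R.
Proof.
rewrite !maxEle oppr_le0; have [t0|t0] := leP t 0%R.
  case: ifP => t0'; [lra|].
  have : (t <> 0)%R by move=> t0''; move: t0'; rewrite t0'' lexx.
  lra.
by case: ifP => t0'; lra.
Qed.

Let integrable_max0 (h : T -> R) : L1 h -> L1 (fun w => Num.max (h w) 0%R).
Proof.
move=> /[dup] /integrableP[/measurable_EFinP mh _] ih.
apply: (le_integrable measurableT _ _ ih).
  by apply/measurable_EFinP; apply: measurable_maxr.
move=> w _ /=; rewrite lee_fin maxEle; case: ifP => // _; rewrite normr0.
exact: normr_ge0.
Qed.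

(** Signed version, by splitting both factors into positive and negative parts. *)
Lemma expectation_indep_pairM (f : {mfun T >-> T1}) (g : {mfun T >-> T2})
    (a : T1 -> R) (b : T2 -> R) :
    indep_pair f g -> measurable_fun setT a -> measurable_fun setT b ->
    L1 (a \o f) -> L1 (b \o g) ->
  (\E (fun w => a (f w) * b (g w)) = \E (a \o f) * \E (b \o g))%R.
Proof.
move=> fg.
have pp (a' : T1 -> R) (b' : T2 -> R) :
    measurable_fun setT a' -> measurable_fun setT b' ->
    L1 (a' \o f) -> L1 (b' \o g) ->
    (forall x, 0 <= a' x)%R -> (forall x, 0 <= b' x)%R ->
    (\E (fun w => a' (f w) * b' (g w)) = \E (a' \o f) * \E (b' \o g))%R.
  move=> ma mb af bg a0 b0; rewrite /Rintegral -fineM ?integrable_fin_num//.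
  congr fine; under eq_integral do rewrite EFinM.
  rewrite (@ge0_integral_indep_pairM f g (EFin \o a') (EFin \o b') fg)//;
    by [exact/measurable_EFinP | move=> x; rewrite lee_fin].
have mmax d' (S : measurableType d') (h : S -> R) :
    measurable_fun setT h -> measurable_fun setT (fun x => Num.max (h x) 0%R).
  by move=> mh; exact: measurable_maxr.
have mN d' (S : measurableType d') (h : S -> R) :
    measurable_fun setT h -> measurable_fun setT (fun x => - h x)%R.
  by move=> mh; exact: measurableT_comp.
have iN (h : T -> R) : L1 h -> L1 (fun x => - h x)%R.
  by move=> ih; rewrite (_ : _ \o _ = (\- (EFin \o h))) ?integrableN//.
have mx0 (x : R) : (0 <= Num.max x 0)%R by rewrite le_max lexx orbT.
have pb (a' : T1 -> R) (b' : T2 -> R) :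
    measurable_fun setT a' -> measurable_fun setT b' ->
    L1 (a' \o f) -> L1 (b' \o g) ->
    (forall x, 0 <= a' x)%R ->
    (\E (fun w => a' (f w) * b' (g w)) = \E (a' \o f) * \E (b' \o g))%R.
  move=> ma mb ia ib a0.
  have mb1 := mmax _ _ _ mb; have mb2 := mmax _ _ _ (mN _ _ _ mb).
  have ib1 := integrable_max0 ib; have ib2 := integrable_max0 (iN _ ib).
  transitivity (\E (fun w => a' (f w) * Num.max (b' (g w)) 0 -
                             a' (f w) * Num.max (- b' (g w)) 0))%R.
    by apply: eq_Rintegral => w _; rewrite -mulrBr -maxr0_split.
  rewrite RintegralB//; last 2 first.
  - exact: (@integrable_indep_pairM f g a' _ fg ma mb1).
  - exact: (@integrable_indep_pairM f g a' _ fg ma mb2).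
  rewrite (pp a' _ ma mb1)// (pp a' _ ma mb2)// -mulrBr; congr (_ * _)%R.
  rewrite -RintegralB//; apply: eq_Rintegral => w _ /=; exact/esym/maxr0_split.
move=> ma mb ia ib.
have ma1 := mmax _ _ _ ma; have ma2 := mmax _ _ _ (mN _ _ _ ma).
have ia1 := integrable_max0 ia; have ia2 := integrable_max0 (iN _ ia).
transitivity (\E (fun w => Num.max (a (f w)) 0 * b (g w) -
                           Num.max (- a (f w)) 0 * b (g w)))%R.
  by apply: eq_Rintegral => w _; rewrite -mulrBl -maxr0_split.
rewrite RintegralB//; last 2 first.
- exact: (@integrable_indep_pairM f g _ b fg ma1 mb).
- exact: (@integrable_indep_pairM f g _ b fg ma2 mb).
rewrite (pb _ b ma1 mb)// (pb _ b ma2 mb)// -mulrBl; congr (_ * _)%R.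
rewrite -RintegralB//; apply: eq_Rintegral => w _ /=; exact/esym/maxr0_split.
Qed.
End joint_law.
End independent_pair.

(** * Grouping of mutually independent variables *)

Section generated_sigma_algebra.
Context d (T : measurableType d) (R : realType) (P : probability T R).
Context (I : finType) (Z : I -> {RV P >-> R}).
Implicit Types (J : {set I}) (i k : I) (f g : T -> R).

(** A family stable under intersection which generates the sigma-algebra of
    the variables Z_i, i in J. *)
Definition cylinders (J : {set I}) : set (set T) :=
  [set E | exists2 A : I -> set R, (forall i, measurable (A i)) &
           E = \bigcap_(i in [set` J]) (Z i @^-1` A i)].

Definition determined_by (J : {set I}) (f : T -> R) : Prop :=
  measurable_fun setT (f : g_sigma_algebraType (cylinders J) -> R).

Lemma cylindersT J : cylinders J setT.
Proof.
exists (fun=> setT) => //.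
by apply/esym; rewrite -subTset => w _ i _.
Qed.

Lemma cylinders_setI J : setI_closed (cylinders J).
Proof.
move=> _ _ [A mA ->] [B mB ->]; exists (fun i => A i `&` B i).
  by move=> i; exact: measurableI.
by rewrite -bigcapI.
Qed.

Lemma measurable_preimage_RV (k : I) (B : set R) :
  measurable B -> d.-measurable (Z k @^-1` B).
Proof.
move=> mB; rewrite -[X in measurable X]setTI.
exact: measurable_funPT.
Qed.

Lemma cylinders_measurable J : cylinders J `<=` @measurable d T.
Proof.
move=> _ [A mA ->].
apply: fin_bigcap_measurable => // i _; exact: measurable_preimage_RV.
Qed.

Lemma determined_by_RV J i : i \in J -> determined_by J (Z i).
Proof.
move=> iJ _ A mA; rewrite setTI; apply: sub_sigma_algebra.
exists (fun j => if j == i then A else setT); first by move=> j; case: ifP.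
apply/seteqP; split => w /=.
  by move=> Aw j jJ; case: eqP => [->|].
by move=> /(_ i iJ); rewrite /= eqxx.
Qed.

Lemma determined_by_cst J c : determined_by J (cst c).
Proof. exact: measurable_cst. Qed.

Lemma determined_byM J f g :
  determined_by J f -> determined_by J g -> determined_by J (f \* g).
Proof. exact: measurable_funM. Qed.

Lemma determined_byD J f g :
  determined_by J f -> determined_by J g -> determined_by J (f \+ g).
Proof. exact: measurable_funD. Qed.

Lemma determined_by_measurable J f : determined_by J f -> measurable_fun setT f.
Proof.
move=> mf _ A mA; have := mf measurableT A mA.
apply: smallest_sub; last exact: cylinders_measurable.
exact: sigma_algebra_measurable.
Qed.

Hypothesis indep_Z : mutually_independent P Z.

(** A cylinder of J intersected with an event of Z_k is a cylinder of
    k |: J, so that mutual independence is used twice. *)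
Lemma cylinders_indep (J : {set I}) (k : I) (B : set R) E :
    k \notin J -> measurable B -> cylinders J E ->
  P (E `&` Z k @^-1` B) = (P (Z k @^-1` B) * P E)%E.
Proof.
move=> kJ mB [A mA ->].
pose A' i := if i == k then B else A i.
have mA' i : measurable (A' i) by rewrite /A'; case: ifP.
have A'J i : i \in J -> A' i = A i.
  by rewrite /A'; case: eqP => // -> /(negP kJ).
have := indep_Z (k |: J) mA'; rewrite big_setU1//= {2}/A' eqxx.
rewrite (eq_bigr (fun i => P (Z i @^-1` A i))); last by move=> i iJ; rewrite A'J.
rewrite -(indep_Z J mA) => <-; congr (P _); apply/seteqP; split => w /=.
  move=> [Aw Bw] i /=; rewrite in_setU1 => /orP[/eqP->|iJ].
    by rewrite /A' eqxx.
  by rewrite A'J//; exact: Aw.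
move=> Aw; split; last by have := Aw k; rewrite /= setU11 /A' eqxx; exact.
by move=> i iJ; have := Aw i; rewrite /= (setU1r _ iJ) A'J//; exact.
Qed.

(** For a fixed event of Z_k, both sides are finite measures in the other
    event, and they agree on the cylinders of J by [cylinders_indep]. *)
Lemma determined_by_indep (J : {set I}) (k : I) f :
  k \notin J -> determined_by J f -> indep_pair P f (Z k).
Proof.
move=> kJ mf A B mA mB.
have mZB := measurable_preimage_RV k mB.
have r0 : (0 <= fine (P (Z k @^-1` B)))%R by rewrite fine_ge0.
pose m2 := mscale (NngNum r0) P.
have rE : (fine (P (Z k @^-1` B)))%:E = P (Z k @^-1` B) by rewrite fineK ?fin_num_measure.
rewrite muleC -rE -[LHS]/(mrestr P mZB (f @^-1` A)) -[RHS]/(m2 (f @^-1` A)).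
apply: (@g_sigma_algebra_measure_unique _ _ _ (cylinders J) _ (fun=> setT)).
- exact: cylinders_measurable.
- by move=> _; exact: cylindersT.
- by rewrite bigcup_const.
- exact: cylinders_setI.
- by move=> E JE; rewrite /mrestr/= /mscale/= rE; exact: cylinders_indep JE.
- by move=> _; rewrite /= /mrestr setTI ltey_eq fin_num_measure.
- by have := mf measurableT A mA; rewrite setTI.
Qed.

End generated_sigma_algebra.

(** * A power inequality *)

Section power_inequality.
Context {R : realFieldType}.
Implicit Types (t x y K a b : R) (n l : nat).

Lemma exprD_ge x y l : 1 <= x -> 0 <= y -> x ^+ l + l%:R * y <= (x + y) ^+ l.
Proof.
move=> x1 y0; elim: l => [|l IH]; first by rewrite !expr0 mul0r addr0.
have xl1 : 1 <= x ^+ l by rewrite exprn_ege1.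
have l0 : 0 <= l%:R :> R by rewrite ler0n.
rewrite [leRHS]exprSr (le_trans _ (ler_wpM2r _ IH))//; last lra.
rewrite exprSr -natr1.
have : 0 <= l%:R * y * (x - 1 + y).
  by apply: mulr_ge0; [exact: mulr_ge0|lra].
have : 0 <= (x ^+ l - 1) * y by rewrite mulr_ge0//; lra.
nra.
Qed.

Lemma expr1D_le t n : n%:R * `|t| <= 1 ->
  (1 + t) ^+ n <= 1 + n%:R * t + n%:R ^+ 2 * t ^+ 2.
Proof.
elim: n => [|n IH]; first by rewrite expr0 !mul0r expr0n/= mul0r !addr0.
rewrite -natr1 => nt.
have n0 : 0 <= n%:R :> R by rewrite ler0n.
have t0 : 0 <= `|t| by rewrite normr_ge0.
have nt0 : 0 <= n%:R * `|t| by rewrite mulr_ge0.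
have nt1 : n%:R * `|t| <= 1 by nra.
have tN : - `|t| <= t <= `|t| by rewrite -ler_norml.
have t1 : 0 <= 1 + t by nra.
rewrite exprSr (le_trans (ler_wpM2r t1 (IH nt1)))//.
have ntt : n%:R * t <= 1.
  by rewrite (le_trans _ nt1)// ler_wpM2l//; case/andP: tN.
have t20 : 0 <= t ^+ 2 by rewrite sqr_ge0.
have ntt2 : 0 <= n%:R * t ^+ 2 by exact: mulr_ge0.
have : 0 <= n%:R * t ^+ 2 * (1 - n%:R * t) by rewrite mulr_ge0 ?subr_ge0.
have : 0 <= t ^+ 2 * (n%:R + 1) by rewrite mulr_ge0//; lra.
nra.
Qed.

(** The dehomogenized form. When 2 l |t| <= 1 the left-hand side is controlled
    by its expansion of order two; otherwise the quadratic term dominates, as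
    (1 + |t|)^2 + 2 |t| <= 1 + K t^2. *)
Lemma expr1D_even_le t K l : 8 * l%:R + 1 <= K ->
  (1 + t) ^+ l.*2 <= l.*2%:R * t + (1 + K * t ^+ 2) ^+ l.
Proof.
move=> lK.
have t20 : 0 <= t ^+ 2 by rewrite sqr_ge0.
have l0 : 0 <= l%:R :> R by rewrite ler0n.
have Kt0 : 0 <= K * t ^+ 2 by rewrite mulr_ge0//; lra.
have n2 : l.*2%:R = 2 * l%:R :> R by rewrite -mul2n natrM.
have [small|large] := leP (l.*2%:R * `|t|) 1.
  rewrite (le_trans (expr1D_le small))//.
  have := exprD_ge l (lexx (1 : R)) Kt0; rewrite expr1n n2 => h.
  have : 0 <= l%:R * (K - 8 * l%:R - 1) * t ^+ 2.
    by apply: mulr_ge0 => //; apply: mulr_ge0 => //; lra.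
  nra.
have t0 : 0 <= `|t| by rewrite normr_ge0.
have tE : t ^+ 2 = `|t| ^+ 2 by rewrite real_normK// num_real.
have tN : - `|t| <= t <= `|t| by rewrite -ler_norml.
have base : (1 + `|t|) ^+ 2 + 2 * `|t| <= 1 + K * t ^+ 2.
  rewrite tE; rewrite n2 in large.
  have : 0 <= `|t| * ((K - 8 * l%:R - 1) * `|t|).
    by do 2!(apply: mulr_ge0 => //); lra.
  have : 0 <= `|t| * (2 * l%:R * `|t| - 1) by apply: mulr_ge0 => //; lra.
  nra.
have x1 : 1 <= (1 + `|t|) ^+ 2 by rewrite exprn_ege1//; lra.
have := exprD_ge l x1 (mulr_ge0 (ler0n _ 2) t0) => h1.
have h2 : ((1 + `|t|) ^+ 2 + 2 * `|t|) ^+ l <= (1 + K * t ^+ 2) ^+ l.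
  by rewrite lerXn2r// nnegrE; nra.
have h3 : (1 + t) ^+ l.*2 <= ((1 + `|t|) ^+ 2) ^+ l.
  rewrite -mul2n exprM lerXn2r// ?nnegrE ?sqr_ge0//.
  by rewrite -(real_normK (num_real (1 + t))) lerXn2r ?nnegrE ?normr_ge0 ?addr_ge0// (le_trans (ler_normD _ _))// normr1.
have : - (l.*2%:R * `|t|) <= l.*2%:R * t.
  by rewrite -mulrN ler_wpM2l ?ler0n//; case/andP: tN.
rewrite n2; nra.
Qed.

(** The odd term of lowest order is kept exactly because its expectation
    vanishes; the others are absorbed in a sum that expands in even powers. *)
Lemma exprD_even_le a b K l : 8 * l%:R + 1 <= K ->
  (a + b) ^+ l.*2 <=
    l.*2%:R * (a ^+ l.*2.-1 * b) + (a ^+ 2 + K * b ^+ 2) ^+ l.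
Proof.
case: l => [|l] lK; first by rewrite !expr0 mul0r add0r.
have [->|a0] := eqVneq a 0.
  rewrite expr0n/= !mul0r mulr0 !add0r expr0n/= add0r exprMn -mul2n exprM.
  apply: ler_peMl; first by rewrite exprn_ge0 ?sqr_ge0.
  apply: exprn_ege1.
  by have := ler0n R l.+1; lra.
have /(ler_wpM2l (_ : 0 <= a ^+ l.+1.*2)) := expr1D_even_le (b / a) lK.
rewrite -exprMn mulrDr mulr1 (mulrC a (b / a)) divfK// => h.
rewrite (le_trans (h _)) ?exprn_even_ge0 ?odd_double//.
rewrite mulrDr le_eqVlt; apply/orP; left; apply/eqP; congr (_ + _).
  by rewrite doubleS/= (exprSr _ l.*2.+1); field.
by rewrite -mul2n (exprM _ 2) -exprMn; congr (_ ^+ _); field.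
Qed.

End power_inequality.

(** * Even moments of sums of independent variables *)

Section moments.
Context d (T : measurableType d) (R : realType) (P : probability T R).
Local Notation L1 f := (P.-integrable setT (EFin \o f)).
Local Notation "\E f" := (\int[P]_w f w)%R (at level 10, f at level 9).
Implicit Types f g : T -> R.

Lemma L1_measurable f : L1 f -> measurable_fun setT f.
Proof. by move=> /integrableP[/measurable_EFinP]. Qed.

Lemma L1_le f g : measurable_fun setT f -> L1 g ->
  (forall w, `|f w| <= g w) -> L1 f.
Proof.
move=> mf ig fg; apply: (le_integrable measurableT _ _ ig).
  exact/measurable_EFinP.
by move=> w _; rewrite /= lee_fin (le_trans (fg w))// ler_norm.
Qed.

Lemma L1_cst (c : R) : L1 (fun=> c).
Proof.
rewrite (_ : _ \o _ = cst c%:E)//; exact: finite_measure_integrable_cst.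
Qed.

Lemma L1Zl (c : R) f : L1 f -> L1 (fun w => c * f w).
Proof. by move=> /(integrableZl measurableT c). Qed.

Lemma L1D f g : L1 f -> L1 g -> L1 (fun w => f w + g w).
Proof. by move=> /integrableD /[apply] => /(_ measurableT). Qed.

Lemma L1_sum (I : Type) (s : seq I) (F : I -> T -> R) :
  (forall i, L1 (F i)) -> L1 (fun w => \sum_(i <- s) F i w).
Proof.
move=> iF; elim: s => [|i s IH].
  by under [X in EFin \o X]eq_fun do rewrite big_nil; exact: L1_cst.
by under [X in EFin \o X]eq_fun do rewrite big_cons; exact: L1D.
Qed.

Lemma expectationRE f : L1 f -> 'E_P[f]%E = (\E f)%:E.
Proof.
by move=> i_f; rewrite unlock /Rintegral fineK//; exact: integrable_fin_num.
Qed.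

Lemma expectation_cst1 (c : R) : \E (fun=> c) = c.
Proof. by rewrite Rintegral_cst//= [X in fine X]probability_setT mulr1. Qed.

Lemma expectation_sumE (I : Type) (s : seq I) (F : I -> T -> R) :
  (forall i, L1 (F i)) ->
  \E (fun w => \sum_(i <- s) F i w) = \sum_(i <- s) \E (F i).
Proof.
move=> iF; elim: s => [|i s IH].
  rewrite big_nil -[RHS](expectation_cst1 0).
  by apply: eq_Rintegral => w _; rewrite big_nil.
rewrite big_cons -IH -RintegralD//; last exact: L1_sum.
by apply: eq_Rintegral => w _; rewrite big_cons.
Qed.

(** The lower powers are dominated by one plus the higher even power. *)
Lemma L1_expn f m n : (m <= n.*2)%N -> measurable_fun setT f ->
  L1 (fun w => f w ^+ n.*2) -> L1 (fun w => f w ^+ m).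
Proof.
move=> mn mf ifn; apply: (L1_le (g := fun w => 1 + f w ^+ n.*2)).
- exact: measurable_funX.
- by apply: L1D => //; exact: L1_cst.
- move=> w; rewrite normrX.
  have e0 : 0 <= f w ^+ n.*2 by rewrite exprn_even_ge0 ?odd_double.
  have [f1|/ltW f1] := leP `|f w| 1.
    by rewrite (le_trans (exprn_ile1 _ (normr_ge0 _) f1))// lerDl.
  rewrite -(ger0_norm e0) normrX (le_trans (ler_weXn2l f1 mn))// lerDr.
  by lra.
Qed.

Section independent_sums.
Context (I : finType) (Z : I -> {RV P >-> R}).
Hypothesis indep_Z : mutually_independent P Z.

Lemma determined_by_lin (J : {set I}) (u : I -> R) (s : seq I) :
    {subset s <= J} ->
  determined_by Z J (fun w => \sum_(i <- s) u i * Z i w).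
Proof.
elim: s => [|i s IH] sJ.
  under [X in determined_by _ _ X]eq_fun do rewrite big_nil.
  exact: determined_by_cst.
under [X in determined_by _ _ X]eq_fun do rewrite big_cons.
apply: (@determined_byD _ _ _ _ _ _ _ (fun w => u i * Z i w)).
  apply: (@determined_byM _ _ _ _ _ _ _ (fun=> u i)).
    exact: determined_by_cst.
  by apply: determined_by_RV; apply: sJ; rewrite mem_head.
by apply: IH => j js; apply: sJ; rewrite in_cons js orbT.
Qed.

Lemma determined_by_expectM (J : {set I}) (k : I) f m n :
    k \notin J -> determined_by Z J f ->
    L1 (fun w => f w ^+ m) -> L1 (fun w => Z k w ^+ n) ->
  L1 (fun w => f w ^+ m * Z k w ^+ n) /\
  \E (fun w => f w ^+ m * Z k w ^+ n) =
  \E (fun w => f w ^+ m) * \E (fun w => Z k w ^+ n).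
Proof.
move=> kJ Jf iF iZ.
have mf := determined_by_measurable Jf.
pose F : {mfun T >-> R} := mfun_Sub (mem_set mf).
have FZ : indep_pair P F (Z k) := determined_by_indep indep_Z kJ Jf.
have mX (r : nat) : measurable_fun setT (fun x : R => x ^+ r).
  exact: measurable_funX.
split.
- exact: (integrable_indep_pairM FZ (mX m) (mX n)).
- exact: (expectation_indep_pairM FZ (mX m) (mX n)).
Qed.

Lemma expectation_mul_centered (J : {set I}) (k : I) f :
    k \notin J -> determined_by Z J f -> L1 f -> L1 (Z k) -> \E (Z k) = 0 ->
  \E (fun w => f w * Z k w) = 0.
Proof.
move=> kJ Jf iF iZ EZ.
have X1 g : (fun w => g w ^+ 1) = g by apply/funext => w; rewrite expr1.
have [||_ E1] := determined_by_expectM (m := 1) (n := 1) kJ Jf; rewrite ?X1//.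
transitivity (\E (fun w => f w ^+ 1 * Z k w ^+ 1)).
  by apply: eq_Rintegral => w _; rewrite !expr1.
by rewrite E1 !X1 EZ mulr0.
Qed.

(** By induction on the summands. The bound reproduces itself: the binomial
    sum of the bounds for S and for u_i Z_i is the bound for their sum. *)
Lemma even_moment_sum_le (u : I -> R) (k : nat) (K mu : R) (s : seq I) :
    8 * k%:R + 1 <= K -> 0 <= mu ->
    (forall i, \E (Z i) = 0) ->
    (forall i l, (l <= k)%N ->
      L1 (fun w => Z i w ^+ l.*2) /\ \E (fun w => Z i w ^+ l.*2) <= mu ^+ l) ->
    uniq s -> forall l, (l <= k)%N ->
  L1 (fun w => (\sum_(i <- s) u i * Z i w) ^+ l.*2) /\
  \E (fun w => (\sum_(i <- s) u i * Z i w) ^+ l.*2) <=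
    (K * mu * \sum_(i <- s) u i ^+ 2) ^+ l.
Proof.
move=> Kk mu0 EZ momZ; elim: s => [_ l lk|i s IH /= /andP[iNs us] l lk].
  have -> : (fun w => (\sum_(i <- [::]) u i * Z i w) ^+ l.*2) =
            (fun=> 0 ^+ l.*2).
    by apply/funext => w; rewrite big_nil.
  split; first exact: L1_cst.
  by rewrite expectation_cst1 big_nil mulr0 !expr0n; case: l {lk}.
have {}IH := IH us.
pose S w := \sum_(j <- s) u j * Z j w.
pose J : {set I} := [set j in s]%SET.
have iJ : i \notin J by rewrite inE.
have JS : determined_by Z J S by apply: determined_by_lin => j; rewrite inE.
have mS := determined_by_measurable JS.
have l0 : (0 < l)%N -> (0 < k)%N by move=> /leq_trans; apply.
set v := \sum_(j <- s) _ in IH.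
have v0 : 0 <= v by apply: sumr_ge0 => j _; exact: sqr_ge0.
rewrite big_cons -/v.
have -> : (fun w => (\sum_(j <- i :: s) u j * Z j w) ^+ l.*2) =
          (fun w => (S w + u i * Z i w) ^+ l.*2).
  by apply/funext => w; rewrite big_cons addrC.
have K0 : 0 <= K by have := ler0n R k; lra.
have lkR : l%:R <= k%:R :> R by rewrite ler_nat.
have lK : 8 * l%:R + 1 <= K by lra.
have [l_eq0|l_gt0] := posnP l.
  rewrite l_eq0 expr0 (_ : (fun w => _) = (fun=> 1)); last exact/funext.
  by split; [exact: L1_cst|rewrite expectation_cst1].
(* The terms of the bound given by [exprD_even_le], up to constants: [B1] has
   mean zero because Z_i has, and [B2 j] is the j-th term of the binomial
   expansion. *)
pose B1 w := S w ^+ l.*2.-1 * Z i w ^+ 1.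
pose B2 j w := S w ^+ (l - j).*2 * Z i w ^+ j.*2.
have [iB1 EB1] : L1 B1 /\ \E B1 = 0.
  have iZ : L1 (fun w => Z i w ^+ 1).
    apply: (L1_expn (n := 1)) => //.
    by have [] := momZ i 1%N (l0 l_gt0).
  have iS : L1 (fun w => S w ^+ l.*2.-1).
    by apply: (L1_expn (n := l)) => //; [exact: leq_pred | have [] := IH l lk].
  have [? ->] := determined_by_expectM iJ JS iS iZ; split => //.
  rewrite [X in _ * X](_ : _ = 0) ?mulr0// -[RHS](EZ i).
  by apply: eq_Rintegral => w _; rewrite expr1.
have B2P j : (j <= l)%N -> L1 (B2 j) /\
    \E (B2 j) <= (K * mu * v) ^+ (l - j) * mu ^+ j.
  move=> jl.
  have [iS ES] := IH (l - j)%N (leq_trans (leq_subr _ _) lk).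
  have [iZ EZi] := momZ i j (leq_trans jl lk).
  have [? ->] := determined_by_expectM iJ JS iS iZ; split => //.
  apply: ler_pM => //; apply: Rintegral_ge0 => w _;
    by rewrite exprn_even_ge0 ?odd_double.
pose g w := l.*2%:R * u i * B1 w +
  \sum_(j < l.+1) ((K * u i ^+ 2) ^+ j *+ 'C(l, j)) * B2 j w.
have gE w : g w = l.*2%:R * (S w ^+ l.*2.-1 * (u i * Z i w)) +
    (S w ^+ 2 + K * (u i * Z i w) ^+ 2) ^+ l.
  have -> : K * (u i * Z i w) ^+ 2 = (K * u i ^+ 2) * Z i w ^+ 2.
    by rewrite exprMn mulrA.
  rewrite /g /B1 expr1 exprDn; congr (_ + _).
    by rewrite -!mulrA; congr (_ * _); rewrite mulrCA.
  apply: eq_bigr => j _; rewrite /B2 mulrnAl; congr (_ *+ _).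
  by rewrite -!mul2n !(exprM _ 2) mulrCA; congr (_ * _); rewrite -exprMn.
have ig : L1 g.
  apply: L1D; first exact: L1Zl.
  by apply: L1_sum => j; apply: L1Zl; have [] := B2P j (ltn_ord j).
have pg w : (S w + u i * Z i w) ^+ l.*2 <= g w.
  by rewrite gE; exact: exprD_even_le.
have iL : L1 (fun w => (S w + u i * Z i w) ^+ l.*2).
  apply: L1_le ig _.
    apply: measurable_funX; apply: measurable_funD => //.
    by apply: measurable_funM => //; exact: (measurable_funPT (Z i)).
  by move=> w; rewrite ger0_norm// exprn_even_ge0 ?odd_double.
split => //.
apply: (le_trans (le_Rintegral _ iL ig _)) => //.
rewrite RintegralD//; last 2 first.
- exact: L1Zl.
- by apply: L1_sum => j; apply: L1Zl; have [] := B2P j (ltn_ord j).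
rewrite RintegralZl// EB1 mulr0 add0r expectation_sumE; last first.
  by move=> j; apply: L1Zl; have [] := B2P j (ltn_ord j).
rewrite mulrDr addrC exprDn; apply: ler_sum => j _.
have [iB2 EB2] := B2P j (ltn_ord j).
rewrite RintegralZl//.
apply: (le_trans (ler_wpM2l _ EB2)).
  by rewrite mulrn_wge0// exprn_ge0// mulr_ge0// sqr_ge0.
rewrite mulrnAl le_eqVlt; apply/orP; left; apply/eqP; congr (_ *+ _).
by rewrite mulrCA -exprMn; congr (_ * _ ^+ _); rewrite mulrAC.
Qed.
End independent_sums.
End moments.

(** * Growth of the L^q norms of linear forms *)

Section growth.
Context d (T : measurableType d) (R : realType) (P : probability T R).
Local Notation L1 f := (P.-integrable setT (EFin \o f)).
Local Notation "\E f" := (\int[P]_w f w)%R (at level 10, f at level 9).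
Implicit Types (f U : T -> R) (q nu c N : R).

Lemma Lq_norm_powR q U : q != 0 ->
  (Lq_norm P q U `^ q = \int[P]_w (`|U w| `^ q)%:E)%E.
Proof.
move=> q0; rewrite /Lq_norm poweR_Lnorm//.
Qed.

Lemma Lq_norm_ge0 q U : (0 <= Lq_norm P q U)%E.
Proof. exact: Lnorm_ge0. Qed.

Lemma Lq_normE q U : q != 0 ->
  (Lq_norm P q U = (\int[P]_w (`|U w| `^ q)%:E) `^ q^-1)%E.
Proof.
move=> q0; rewrite -Lq_norm_powR// -poweRrM divff// poweRe1//.
exact: Lq_norm_ge0.
Qed.

Lemma Lq_norm_le q U N : 0 < q -> 0 <= N ->
  (\int[P]_w (`|U w| `^ q)%:E <= (N `^ q)%:E)%E -> (Lq_norm P q U <= N%:E)%E.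
Proof.
move=> q0 N0 UN.
have -> : N%:E = ((N `^ q)%:E `^ q^-1)%E.
  by rewrite poweR_EFin -powRrM divff ?gt_eqF// powRr1.
rewrite Lq_normE ?gt_eqF//.
apply: gt0_ler_poweR => //; rewrite ?invr_ge0 ?ltW// in_itv/= leey andbT//.
  by apply: integral_ge0 => w _; rewrite lee_fin powR_ge0.
by rewrite lee_fin powR_ge0.
Qed.

Lemma moment_le_of_Lq_norm l U N : measurable_fun setT U -> 0 <= N ->
    (0 < l)%N -> (Lq_norm P l.*2%:R U <= N%:E)%E ->
  L1 (fun w => U w ^+ l.*2) /\ \E (fun w => U w ^+ l.*2) <= N ^+ l.*2.
Proof.
move=> mU N0 l0 UN.
have l20 : 0 < l.*2%:R :> R by rewrite ltr0n double_gt0.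
have pE w : U w ^+ l.*2 = `|U w| `^ l.*2%:R.
  rewrite powR_mulrn// -normrX ger0_norm//.
  by rewrite exprn_even_ge0 ?odd_double.
have le : (\int[P]_w (U w ^+ l.*2)%:E <= (N ^+ l.*2)%:E)%E.
  under eq_integral do rewrite pE.
  rewrite -Lq_norm_powR ?gt_eqF// -powR_mulrn// -poweR_EFin.
  apply: gt0_ler_poweR => //; rewrite ?ltW// in_itv/= leey andbT ?lee_fin//.
  exact: Lq_norm_ge0.
have e0 w : 0 <= U w ^+ l.*2 by rewrite exprn_even_ge0 ?odd_double.
have i1 : L1 (fun w => U w ^+ l.*2).
  apply/integrableP; split.
    by apply/measurable_EFinP; exact: measurable_funX.
  under eq_integral do rewrite /= ger0_norm//.
  exact: le_lt_trans le (ltry _).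
split => //.
by rewrite -lee_fin /Rintegral fineK//; exact: integrable_fin_num.
Qed.

Lemma Lq_growthP nu U c : (Lq_growth P nu U <= c%:E)%E ->
  forall q, 2 <= q -> (Lq_norm P q U <= (c * q `^ nu)%:E)%E.
Proof.
move=> Uc q q2.
have q0 : 0 < q by lra.
have : ((q `^ (- nu))%:E * Lq_norm P q U <= c%:E)%E.
  by apply: le_trans Uc; apply: ereal_sup_ubound; exists q.
rewrite powRN => h.
rewrite -(@lee_pmul2l _ (q `^ nu)^-1%:E)//; last first.
  by rewrite lte_fin invr_gt0 powR_gt0.
by rewrite -EFinM mulrCA mulVf ?mulr1// gt_eqF// powR_gt0.
Qed.

(** After division by N, |x|^q <= 1 + x^(2k), both for |x| <= 1 and for
    |x| >= 1 since q <= 2 k; hence E |U|^q <= 2 N^q <= (2 N)^q. *)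
Lemma Lq_norm_le_even_moment q k N U : measurable_fun setT U -> 0 < N ->
    1 <= q -> q <= k.*2%:R ->
    L1 (fun w => U w ^+ k.*2) -> \E (fun w => U w ^+ k.*2) <= N ^+ k.*2 ->
  (Lq_norm P q U <= (2 * N)%:E)%E.
Proof.
move=> mU N0 q1 qk iU EU; have q0 : 0 < q by lra.
apply: Lq_norm_le => //; first by lra.
pose g w := N `^ q * (1 + N ^- k.*2 * U w ^+ k.*2).
have Nk0 : 0 < N ^+ k.*2 by rewrite exprn_gt0.
have iN : L1 (fun w => N ^- k.*2 * U w ^+ k.*2) by exact: L1Zl.
have i1N : L1 (fun w => 1 + N ^- k.*2 * U w ^+ k.*2).
  by apply: L1D => //; exact: L1_cst.
have ig : L1 g by exact: L1Zl.
have Ug w : `|U w| `^ q <= g w.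
  have UNE : `|U w| = N * (`|U w| / N) by rewrite mulrC divfK// gt_eqF.
  have t0 : 0 <= `|U w| / N by rewrite divr_ge0// ltW.
  rewrite {1}UNE powRM ?(ltW N0)// ler_wpM2l ?powR_ge0//.
  have -> : N ^- k.*2 * U w ^+ k.*2 = (`|U w| / N) ^+ k.*2.
    rewrite exprMn exprVn mulrC -normrX ger0_norm//.
    by rewrite exprn_even_ge0 ?odd_double.
  have [t1|/ltW t1] := leP (`|U w| / N) 1.
    rewrite (@le_trans _ _ 1)// ?lerDl ?exprn_ge0//.
    have := ge0_ler_powR (ltW q0) t0 ler01 t1; by rewrite (powR1 R).
  rewrite (le_trans (ler_powR t1 qk))// powR_mulrn// lerDr//.
apply: (@le_trans _ _ (\int[P]_w (g w)%:E)%E).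
  apply: ge0_le_integral => //.
  - apply/measurable_EFinP.
    by apply: (measurableT_comp (measurable_powR q)); exact: measurableT_comp.
  - by apply/measurable_EFinP; exact: L1_measurable ig.
  - by move=> w _; rewrite lee_fin.
rewrite -[leLHS]fineK; last exact: integrable_fin_num.
rewrite lee_fin -/(Rintegral P setT g) RintegralZl// RintegralD//; last exact: L1_cst.
rewrite expectation_cst1 RintegralZl// powRM ?(ltW N0)//.
rewrite mulrC ler_wpM2r ?powR_ge0//.
apply: (@le_trans _ _ 2).
  by have := ler_wpM2l (_ : 0 <= N ^- k.*2) EU; rewrite mulVf ?gt_eqF// invr_ge0 ltW// => /(_ isT); lra.
by apply: le1r_powR => //; lra.
Qed.

End growth.

Section linear_form_growth.
Context d (T : measurableType d) (R : realType) (P : probability T R).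
Local Notation L1 f := (P.-integrable setT (EFin \o f)).
Local Notation "\E f" := (\int[P]_w f w)%R (at level 10, f at level 9).

(** For a given q, [even_moment_sum_le] is used with k close to q / 2, so that
    q <= 2 k <= 2 q: the factor sqrt(8 k + 1) <= 3 sqrt q is responsible for the
    additional exponent 1/2. *)
Lemma Lq_growth_linear_form (I : finType) (Z : I -> {RV P >-> R})
    (u : I -> R) (nu c : R) :
    mutually_independent P Z -> (forall i, \E (Z i) = 0) ->
    \sum_i u i ^+ 2 = 1 -> 0 < nu -> 0 < c ->
    (forall i, (Lq_growth P nu (Z i) <= c%:E)%E) ->
  (Lq_growth P (nu + 2^-1) (fun w => (\sum_i u i * Z i w)%R) <=
     (6 * 2 `^ nu * c)%:E)%E.
Proof.
move=> indep_Z EZ u1 nu0 c0 Zc; apply: ub_ereal_sup => _ [q /= q2 <-].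
pose t := Num.truncn (q / 2); pose k := t.+1.
have q20 : 0 <= q / 2 by lra.
have /andP[tq qt] : t%:R <= q / 2 < t.+1%:R := truncn_itv q20.
have kE : k%:R = t%:R + 1 :> R by rewrite -natr1.
have k2E : k.*2%:R = 2 * k%:R :> R by rewrite -mul2n natrM.
have kq : k.*2%:R <= 2 * q by rewrite k2E; lra.
have qk : q <= k.*2%:R by rewrite -/k in qt; rewrite k2E; lra.
pose b := c * k.*2%:R `^ nu.
have k20 : 0 < k.*2%:R :> R by rewrite ltr0n double_gt0.
have b0 : 0 < b by rewrite mulr_gt0// powR_gt0.
have momZ i l : (l <= k)%N ->
    L1 (fun w => Z i w ^+ l.*2) /\ \E (fun w => Z i w ^+ l.*2) <= (b ^+ 2) ^+ l.
  case: l => [_|l lk].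
    rewrite expr0 (_ : (fun w => _) = (fun=> 1)); last exact/funext.
    by split; [exact: L1_cst|rewrite expectation_cst1].
  rewrite -exprM mul2n; apply: moment_le_of_Lq_norm => //; first exact: ltW.
  have l2 : 2 <= l.+1.*2%:R :> R by rewrite (ler_nat R 2) doubleS.
  apply: (le_trans (Lq_growthP (Zc i) l2)); rewrite lee_fin ler_pM2l//.
  apply: ge0_ler_powR; rewrite ?nnegrE ?ler0n ?(ltW nu0)//.
  by rewrite ler_nat leq_double.
pose K : R := 8 * k%:R + 1.
have K0 : 0 < K by rewrite /K kE; have := ler0n R t; lra.
have [iS ES] := @even_moment_sum_le _ _ _ _ _ Z indep_Z u k K (b ^+ 2)
  (index_enum I) (lexx _) (sqr_ge0 _) EZ momZ (index_enum_uniq I) k (leqnn k).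
pose N := Num.sqrt K * b.
have N0 : 0 < N by rewrite mulr_gt0// sqrtr_gt0.
have NE : (K * b ^+ 2 * \sum_i u i ^+ 2) ^+ k = N ^+ k.*2.
  by rewrite u1 mulr1 -mul2n exprM; congr (_ ^+ k); rewrite [in RHS]exprMn sqr_sqrtr// ltW.
rewrite NE in ES.
have mS : measurable_fun setT (fun w => \sum_i u i * Z i w).
  apply: measurable_sum => i; apply: measurable_funM => //.
have q1 : 1 <= q by lra.
have q0 : 0 < q by lra.
apply: (@le_trans _ _ ((q `^ (- (nu + 2^-1)))%:E * (2 * N)%:E)%E).
  apply: lee_wpmul2l; first by rewrite lee_fin powR_ge0.
  exact: Lq_norm_le_even_moment iS ES.
rewrite -EFinM lee_fin.
have sK : Num.sqrt K <= 3 * q `^ 2^-1.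
  rewrite powR12_sqrt ?(ltW q0)// -[3](@ger0_norm R)// -sqrtr_sqr -sqrtrM ?sqr_ge0//.
  by rewrite ler_wsqrtr// /K; lra.
have bq : b <= c * (2 `^ nu * q `^ nu).
  rewrite ler_pM2l// -powRM//; last exact: ltW.
  by apply: ge0_ler_powR; rewrite ?nnegrE ?ler0n ?(ltW nu0)//; lra.
have Nq : N <= (3 * q `^ 2^-1) * (c * (2 `^ nu * q `^ nu)).
  by apply: ler_pM => //; exact: ltW.
have qq : q `^ (- (nu + 2^-1)) * (q `^ nu * q `^ 2^-1) = 1.
  rewrite -powRD; last by apply/implyP => _; rewrite gt_eqF.
  by rewrite powRN mulVf// gt_eqF// powR_gt0.
apply: (@le_trans _ _ (q `^ (- (nu + 2^-1)) *
    (2 * (3 * q `^ 2^-1 * (c * (2 `^ nu * q `^ nu)))))).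
  by rewrite ler_wpM2l ?powR_ge0// ler_pM2l.
rewrite le_eqVlt; apply/orP; left; apply/eqP.
transitivity (6 * 2 `^ nu * c *
    (q `^ (- (nu + 2^-1)) * (q `^ nu * q `^ 2^-1))); last by rewrite qq mulr1.
by ring.
Qed.

End linear_form_growth.

(** * The spectrum of a self-adjoint operator *)

Section selfadjoint.
Context {R : realType}.

(** The real and imaginary parts of a complex eigenvector x + i y of A, for
    the eigenvalue b + i c. *)
Lemma real_mx_complex_eigenvector n (A : 'M[R]_n) : (0 < n)%N ->
  exists b c : R, exists x y : 'rV[R]_n,
    [/\ x *m A = b *: x - c *: y, y *m A = c *: x + b *: y &
        (x != 0) || (y != 0)].
Proof.
move=> n0; pose AC := map_mx (real_complex R) A.
have /closed_rootP[a] : size (char_poly AC) != 1 by rewrite size_char_poly; case: n n0 {A AC}.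
rewrite -eigenvalue_root_char => /eigenvalueP[v vA v0].
exists (complex.Re a), (complex.Im a), (map_mx (@complex.Re R) v), (map_mx (@complex.Im R) v).
have entry j : \sum_i v 0 i * (A i j)%:C%C = a * v 0 j.
  have /matrixP/(_ 0 j) := vA; rewrite !mxE => <-.
  by apply: eq_bigr => i _; rewrite mxE.
have ReM (z : R[i]) (r : R) : complex.Re (z * r%:C%C) = complex.Re z * r.
  by case: z => z1 z2; rewrite /= mulr0 subr0.
have ImM (z : R[i]) (r : R) : complex.Im (z * r%:C%C) = complex.Im z * r.
  by case: z => z1 z2; rewrite /= mulr0 add0r.
have ReS (F : 'I_n -> R[i]) : complex.Re (\sum_i F i) = \sum_i complex.Re (F i).
  by apply: (big_morph (@complex.Re R)) => // -[? ?] [? ?].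
have ImS (F : 'I_n -> R[i]) : complex.Im (\sum_i F i) = \sum_i complex.Im (F i).
  by apply: (big_morph (@complex.Im R)) => // -[? ?] [? ?].
split.
- apply/rowP => j; rewrite !mxE.
  transitivity (complex.Re (\sum_i v 0 i * (A i j)%:C%C)).
    by rewrite ReS; apply: eq_bigr => i _; rewrite mxE ReM.
  by rewrite entry; case: (a) (v 0 j) => ? ? [? ?].
- apply/rowP => j; rewrite !mxE.
  transitivity (complex.Im (\sum_i v 0 i * (A i j)%:C%C)).
    by rewrite ImS; apply: eq_bigr => i _; rewrite mxE ImM.
  by rewrite entry; case: (a) (v 0 j) => ? ? [? ?] /=; rewrite addrC.
- apply: contraNT v0; rewrite negb_or !negbK => /andP[/eqP x0 /eqP y0].
  apply/eqP/rowP => j; move: x0 y0 => /rowP/(_ j) + /rowP/(_ j).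
  by rewrite !mxE; case: (v 0 j) => ? ? /= -> ->.
Qed.

Lemma leigenvalueP (V : vectType R) (K : 'End(V)) a :
  reflect (exists2 x, x != 0 & K x = a *: x) (passmx.leigenvalue K a).
Proof.
rewrite /passmx.leigenvalue /passmx.leigenspace.
apply: (iffP idP) => [|[x x0 Kx]].
  rewrite -vpick0 => x0; exists (vpick (lker (K - a *: \1%VF))) => //.
  apply/eqP; rewrite -subr_eq0.
  have := memv_pick (lker (K - a *: \1%VF)).
  by rewrite memv_ker add_lfunE opp_lfunE scale_lfunE id_lfunE.
apply: contraNneq x0 => ker0; rewrite -memv0 -ker0 memv_ker.
by rewrite add_lfunE opp_lfunE scale_lfunE id_lfunE Kx subrr.
Qed.

(** The eigenvalues are the roots of the characteristic polynomial. *)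
Lemma leigenvalue_bounded (V : vectType R) (K : 'End(V)) :
  exists B : R, forall a, passmx.leigenvalue K a -> `|a| <= B.
Proof.
pose e := vbasis {:V}.
have eb : basis_of {:V} e := vbasisP _.
pose A := passmx.mxof e e K.
exists (cauchy_bound (char_poly A)) => a.
rewrite /passmx.leigenvalue (passmx.leigenspaceE eb) passmx.vsof_eq0// => ea.
apply/ltW/cauchy_boundP; first exact/monic_neq0/char_poly_monic.
by apply/rootP; rewrite -eigenvalue_root_char.
Qed.

(* This gives access to the linear structure of the coordinate maps. *)
Import passmx.

Section spectrum.
Context (V : vectType R) (sp : V -> V -> R).
Hypothesis spP : forall a x y z, sp (a *: x + y) z = a * sp x z + sp y z.
Hypothesis spC : forall x y, sp x y = sp y x.
Hypothesis sp_gt0 : forall x, x != 0 -> 0 < sp x x.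
Hypothesis V_gt0 : (0 < \dim {:V})%N.
Variable K : 'End(V).
Hypothesis K_self : forall x y, sp x (K y) = sp y (K x).

(** If x + i y is an eigenvector for b + i c, then <x, K y> = <y, K x> gives
    c (|x|^2 + |y|^2) = 0, so c = 0 and the nonzero vector among x, y is an
    eigenvector for b. *)
Lemma selfadjoint_leigenvalue : exists a, passmx.leigenvalue K a.
Proof.
pose e := vbasis {:V}.
have eb : basis_of {:V} e := vbasisP _.
have [b [c [x' [y' [xA yA xy0]]]]] :=
  real_mx_complex_eigenvector (passmx.mxof e e K) V_gt0.
pose x := passmx.vecof e x'; pose y := passmx.vecof e y'.
have Kx : K x = b *: x + (- c) *: y.
  by rewrite (passmx.hom_vecof e eb) xA linearB/= !linearZ/= scalerN scaleNr.
have Ky : K y = c *: x + b *: y.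
  by rewrite (passmx.hom_vecof e eb) yA linearD/= !linearZ/=.
have x0E : (x == 0) = (x' == 0) by exact: passmx.vecof_eq0.
have y0E : (y == 0) = (y' == 0) by exact: passmx.vecof_eq0.
have sp0 z : sp 0 z = 0.
  by have := spP 1 0 0 z; rewrite scaler0 addr0 mul1r => /eqP; rewrite -subr_eq subrr => /eqP.
have spZ a z t : sp (a *: z) t = a * sp z t.
  by rewrite -[a *: z]addr0 spP sp0 addr0.
have sp_ge0 z : 0 <= sp z z.
  by have [->|/sp_gt0/ltW//] := eqVneq z 0; rewrite sp0.
have nz : 0 < sp x x + sp y y.
  move: xy0; rewrite -x0E -y0E => /orP[/sp_gt0|/sp_gt0] ?.
    by rewrite ltr_wpDr.
  by rewrite ltr_wpDl.
have c0 : c = 0.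
  have := K_self x y; rewrite Kx Ky !(spC _ (_ + _)) !spP !spZ (spC y x) => h.
  have /eqP : c * (sp x x + sp y y) = 0 by lra.
  by rewrite mulf_eq0 (gt_eqF nz) orbF => /eqP.
exists b; apply/leigenvalueP.
move: xy0; rewrite -x0E -y0E => /orP[x0|y0]; [exists x|exists y] => //.
  by rewrite Kx c0 oppr0 scale0r addr0.
by rewrite Ky c0 scale0r add0r.
Qed.

Let spectrum := [set a : R | passmx.leigenvalue K a].

Let spectrum_has_inf : has_inf spectrum.
Proof.
have [a ea] := selfadjoint_leigenvalue; have [B KB] := leigenvalue_bounded K.
split; first by exists a.
by exists (- B) => b /KB; rewrite ler_norml => /andP[].
Qed.

Let spectrum_has_sup : has_sup spectrum.
Proof.
have [a ea] := selfadjoint_leigenvalue; have [B KB] := leigenvalue_bounded K.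
split; first by exists a.
by exists B => b /KB; rewrite ler_norml => /andP[].
Qed.

Lemma lambda_min_le_max : lambda_min K <= lambda_max K.
Proof.
have [a ea] := selfadjoint_leigenvalue.
apply: (@le_trans _ _ a).
  exact: (ge_inf spectrum_has_inf.2).
exact: (sup_upper_bound spectrum_has_sup).
Qed.

Lemma lambda_min_ge m : (forall a, passmx.leigenvalue K a -> m <= a) ->
  m <= lambda_min K.
Proof. by move=> mK; apply: lb_le_inf => //; exact: spectrum_has_inf.1. Qed.

Lemma lambda_max_le m : (forall a, passmx.leigenvalue K a -> a <= m) ->
  lambda_max K <= m.
Proof. by move=> mK; apply: ge_sup => //; exact: spectrum_has_sup.1. Qed.

End spectrum.
End selfadjoint.

(** * Covariances of quadratic forms *)

Section second_moments.
Context d (T : measurableType d) (R : realType) (P : probability T R).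
Local Notation L1 f := (P.-integrable setT (EFin \o f)).
Local Notation "\E f" := (\int[P]_w f w)%R (at level 10, f at level 9).
Context (I : finType) (Z : I -> {RV P >-> R}).
Hypothesis indep_Z : mutually_independent P Z.
Hypothesis L1_Z2 : forall i, L1 (fun w => Z i w ^+ 2).
Hypothesis EZ1 : forall i, \E (Z i) = 0.
Hypothesis EZ2 : forall i, \E (fun w => Z i w ^+ 2) = 1.
Implicit Types i j : I.

Let L1_Z1 i : L1 (Z i).
Proof.
rewrite (_ : (Z i : T -> R) = fun w => Z i w ^+ 1).
  exact: (L1_expn (n := 1)).
by apply/funext => w; rewrite expr1.
Qed.

Definition quad (B : I -> I -> R) (w : T) : R :=
  \sum_i \sum_j B i j * (Z i w * Z j w).

Lemma expectation_mul2 i j :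
  L1 (fun w => Z i w * Z j w) /\ \E (fun w => Z i w * Z j w) = (i == j)%:R.
Proof.
split.
  apply: (L1_le (g := fun w => Z i w ^+ 2 + Z j w ^+ 2)).
  - exact: measurable_funM.
  - exact: L1D.
  - move=> w; have := sqr_ge0 (Z i w - Z j w); have := sqr_ge0 (Z i w + Z j w).
    have := sqr_ge0 (Z i w); have := sqr_ge0 (Z j w).
    by rewrite ler_norml => *; apply/andP; split; nra.
have [<-|ij] := eqVneq i j.
  by rewrite -(EZ2 i); apply: eq_Rintegral => w _; rewrite expr2.
have jJ : j \notin [set i]%SET by rewrite inE eq_sym.
have JF : determined_by Z [set i]%SET (Z i) by apply: determined_by_RV; rewrite inE.
exact: (expectation_mul_centered indep_Z jJ JF).
Qed.

Lemma quad_expectation B : L1 (quad B) /\ \E (quad B) = \sum_i B i i.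
Proof.
have iZ i j : L1 (fun w => B i j * (Z i w * Z j w)).
  by apply: L1Zl; exact: (expectation_mul2 i j).1.
split; first by apply: L1_sum => i; exact: L1_sum.
rewrite expectation_sumE; last by move=> i; exact: L1_sum.
apply: eq_bigr => i _; rewrite expectation_sumE// (bigD1 i)//= big1 ?addr0.
  have [? Eii] := expectation_mul2 i i.
  by rewrite RintegralZl// Eii eqxx mulr1.
move=> j ji; have [? Eij] := expectation_mul2 i j.
by rewrite RintegralZl// Eij eq_sym (negbTE ji) mulr0.
Qed.

Definition lin (a : I -> R) (w : T) : R := \sum_i a i * Z i w.

Lemma lin_expectation a : L1 (lin a) /\ \E (lin a) = 0.
Proof.
have iZ i : L1 (fun w => a i * Z i w).
  exact: L1Zl.
split; first exact: L1_sum.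
rewrite expectation_sumE// big1// => i _.
by rewrite RintegralZl// EZ1 mulr0.
Qed.

Lemma lin_expectationM a b :
  L1 (fun w => lin a w * lin b w) /\
  \E (fun w => lin a w * lin b w) = \sum_i a i * b i.
Proof.
have -> : (fun w => lin a w * lin b w) = quad (fun i j => a i * b j).
  apply/funext => w; rewrite /lin mulr_suml; apply: eq_bigr => i _.
  by rewrite mulr_sumr; apply: eq_bigr => j _; ring.
exact: quad_expectation.
Qed.

Lemma lin_covariance a b :
  covariance P (lin a) (lin b) = (\sum_i a i * b i)%:E.
Proof.
have [ia Ea] := lin_expectation a; have [ib Eb] := lin_expectation b.
have [iab Eab] := lin_expectationM a b.
rewrite covarianceE; [|exact/Lfun1_integrable..].
by rewrite !expectationRE// Ea Eb [X in X%:E]Eab mule0 sube0.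
Qed.

End second_moments.

Section fourth_moments.
Context d (T : measurableType d) (R : realType) (P : probability T R).
Local Notation L1 f := (P.-integrable setT (EFin \o f)).
Local Notation "\E f" := (\int[P]_w f w)%R (at level 10, f at level 9).
Context (I : finType) (Z : I -> {RV P >-> R}) (kappa : R).
Hypothesis indep_Z : mutually_independent P Z.
Hypothesis L1_Z4 : forall i, L1 (fun w => Z i w ^+ 4).
Hypothesis EZ1 : forall i, \E (Z i) = 0.
Hypothesis EZ2 : forall i, \E (fun w => Z i w ^+ 2) = 1.
Hypothesis EZ4 : forall i, \E (fun w => Z i w ^+ 4) = kappa.
Implicit Types i j k l : I.

Let L1_Zn i n : (n <= 4)%N -> L1 (fun w => Z i w ^+ n).
Proof. by move=> n4; apply: (L1_expn (n := 2)). Qed.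

Let L1_Z1 i : L1 (Z i).
Proof.
rewrite (_ : (Z i : T -> R) = fun w => Z i w ^+ 1); first exact: L1_Zn.
by apply/funext => w; rewrite expr1.
Qed.

Let L1_Z2 i : L1 (fun w => Z i w ^+ 2). Proof. exact: L1_Zn. Qed.

Let mul4_le (a b c e : R) :
  `|a * b * c * e| <= a ^+ 4 + b ^+ 4 + c ^+ 4 + e ^+ 4.
Proof.
have amgm (x y : R) : `|x * y| <= (x ^+ 2 + y ^+ 2) / 2.
  have := sqr_ge0 (x - y); have := sqr_ge0 (x + y) => h1 h2.
  by rewrite ler_norml; apply/andP; split; nra.
rewrite -mulrA (le_trans (amgm _ _))// !exprMn.
have sq (x y : R) : x ^+ 2 * y ^+ 2 <= x ^+ 4 + y ^+ 4.
  have := amgm (x ^+ 2) (y ^+ 2); rewrite -!exprM => h.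
  have := ler_norm (x ^+ 2 * y ^+ 2).
  have : 0 <= x ^+ 4 by rewrite exprn_even_ge0.
  have : 0 <= y ^+ 4 by rewrite exprn_even_ge0.
  lra.
have := sq a b; have := sq c e.
have [? ? ? ?] : [/\ 0 <= a ^+ 4, 0 <= b ^+ 4, 0 <= c ^+ 4 & 0 <= e ^+ 4].
  by split; rewrite exprn_even_ge0.
lra.
Qed.

Lemma L1_mul4 i j k l : L1 (fun w => Z i w * Z j w * Z k w * Z l w).
Proof.
apply: (L1_le (g := fun w => Z i w ^+ 4 + Z j w ^+ 4 + Z k w ^+ 4 + Z l w ^+ 4)).
- by do !(apply: measurable_funM => //).
- by apply: L1D (L1_Z4 l); apply: L1D (L1_Z4 k); apply: L1D (L1_Z4 j).
- by move=> w; exact: mul4_le.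
Qed.

Let L1_mul3 i j k : L1 (fun w => Z i w * Z j w * Z k w).
Proof.
apply: (L1_le (g := fun w => Z i w ^+ 4 + Z j w ^+ 4 + Z k w ^+ 4 + 1)).
- by do !(apply: measurable_funM => //).
- by apply: L1D (L1_cst P 1); apply: L1D (L1_Z4 k); apply: L1D (L1_Z4 j).
- by move=> w; have := mul4_le (Z i w) (Z j w) (Z k w) 1; rewrite expr1n mulr1.
Qed.

Definition mom4 i j k l := \E (fun w => Z i w * Z j w * Z k w * Z l w).

Let mom4_swap12 i j k l : mom4 i j k l = mom4 j i k l.
Proof. by apply: eq_Rintegral => w _; ring. Qed.

Let mom4_swap23 i j k l : mom4 i j k l = mom4 i k j l.
Proof. by apply: eq_Rintegral => w _; ring. Qed.

Let mom4_swap34 i j k l : mom4 i j k l = mom4 i j l k.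
Proof. by apply: eq_Rintegral => w _; ring. Qed.

Let mom4_unique i j k l : l != i -> l != j -> l != k -> mom4 i j k l = 0.
Proof.
move=> li lj lk; pose J : {set I} := [set i; j; k]%SET.
have lJ : l \notin J by rewrite !inE !negb_or li lj lk.
have JF : determined_by Z J (fun w => Z i w * Z j w * Z k w).
  apply: (@determined_byM _ _ _ _ _ _ _ (fun w => Z i w * Z j w)).
    apply: (@determined_byM _ _ _ _ _ _ _ (Z i));
      by apply: determined_by_RV; rewrite !inE eqxx ?orbT.
  by apply: determined_by_RV; rewrite !inE eqxx ?orbT.
exact: (expectation_mul_centered indep_Z lJ JF (L1_mul3 i j k)).
Qed.

Let mom4_pair i k : i != k -> mom4 i i k k = 1.
Proof.
move=> ik; have kJ : k \notin [set i]%SET by rewrite inE eq_sym.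
have JF : determined_by Z [set i]%SET (Z i) by apply: determined_by_RV; rewrite inE.
have [||_] := @determined_by_expectM _ _ _ _ _ _ indep_Z _ k _ 2 2 kJ JF.
- exact: L1_Zn.
- exact: L1_Zn.
rewrite !EZ2 mulr1 => <-.
by apply: eq_Rintegral => w _; ring.
Qed.

(** The expectation vanishes when one index differs from the three others,
    by [mom4_unique]; what remains is two pairs of equal indices, or four equal
    indices, where the first three terms count 3 in place of kappa. *)
Lemma mom4E i j k l : mom4 i j k l =
  (i == j)%:R * (k == l)%:R + (i == k)%:R * (j == l)%:R +
  (i == l)%:R * (j == k)%:R +
  (kappa - 3) * ((i == j)%:R * (j == k)%:R * (k == l)%:R).
Proof.
have [<-{j}|ij] := eqVneq i j.
  have [<-{l}|kl] := eqVneq k l.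
    have [<-{k}|ik] := eqVneq i k.
      rewrite [LHS](_ : _ = kappa); last first.
        by rewrite -(EZ4 i); apply: eq_Rintegral => w _; ring.
      by rewrite /=; ring.
    by rewrite mom4_pair//=; ring.
  have [ik|ik] := eqVneq i k.
    have -> : mom4 i i k l = 0 by rewrite mom4_unique// ?ik eq_sym.
    by rewrite -ik in kl *; rewrite (negbTE kl)/=; ring.
  have -> : mom4 i i k l = 0 by rewrite mom4_swap34 mom4_unique// eq_sym.
  by rewrite /=; ring.
have [<-{k}|ik] := eqVneq i k.
  have [<-{l}|jl] := eqVneq j l.
    rewrite mom4_swap23 mom4_pair// ?eqxx ?(eq_sym j i) ?(negbTE ij) /=; ring.
  have -> : mom4 i j i l = 0.
    by rewrite mom4_swap23 mom4_swap34 mom4_unique// eq_sym.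
  by rewrite ?eqxx ?(eq_sym j i) ?(negbTE ij)/=; ring.
have [<-{l}|il] := eqVneq i l.
  have [<-{k ik}|jk] := eqVneq j k.
    by rewrite mom4_swap34 mom4_swap23 mom4_pair// /=; ring.
  have -> : mom4 i j k i = 0.
    by rewrite mom4_swap23 mom4_swap34 mom4_swap23 mom4_swap34 mom4_unique// eq_sym.
  by rewrite /=; ring.
have -> : mom4 i j k l = 0.
  by rewrite mom4_swap12 mom4_swap23 mom4_swap34 mom4_unique.
by rewrite /=; ring.
Qed.

Let sum_delta (F : I -> R) i : \sum_j F j * (i == j)%:R = F i.
Proof.
rewrite (bigD1 i)//= eqxx mulr1 big1 ?addr0// => j ji.
by rewrite eq_sym (negbTE ji) mulr0.
Qed.

Let sum_mom4 (B' : I -> I -> R) i j :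
  \sum_k \sum_l B' k l * mom4 i j k l =
  (i == j)%:R * (\sum_k B' k k) + B' i j + B' j i +
  (kappa - 3) * ((i == j)%:R * B' j j).
Proof.
transitivity (\sum_k ((i == j)%:R * B' k k + B' k j * (i == k)%:R +
    B' k i * (j == k)%:R + (kappa - 3) * (i == j)%:R * (B' k k * (j == k)%:R))).
  apply: eq_bigr => k _; under eq_bigr do rewrite mom4E.
  transitivity (\sum_l ((i == j)%:R * (B' k l * (k == l)%:R) +
      (i == k)%:R * (B' k l * (j == l)%:R) + (j == k)%:R * (B' k l * (i == l)%:R) +
      (kappa - 3) * (i == j)%:R * (j == k)%:R * (B' k l * (k == l)%:R))).
    by apply: eq_bigr => l _; ring.
  by rewrite !big_split/= -!mulr_sumr !sum_delta; ring.
rewrite !big_split/= -!mulr_sumr !sum_delta.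
ring.
Qed.

Lemma quad_expectationM (B B' : I -> I -> R) :
    (forall i j, B' i j = B' j i) ->
  L1 (fun w => quad Z B w * quad Z B' w) /\
  \E (fun w => quad Z B w * quad Z B' w) =
  (\sum_i B i i) * (\sum_i B' i i) + 2 * (\sum_i \sum_j B i j * B' i j) +
  (kappa - 3) * (\sum_i B i i * B' i i).
Proof.
move=> symB'.
pose f i j k l w := B i j * B' k l * (Z i w * Z j w * Z k w * Z l w).
have fE : (fun w => quad Z B w * quad Z B' w) =
          (fun w => \sum_i \sum_j \sum_k \sum_l f i j k l w).
  apply/funext => w; rewrite /quad mulr_suml; apply: eq_bigr => i _.
  rewrite mulr_suml; apply: eq_bigr => j _; rewrite mulr_sumr.
  apply: eq_bigr => k _; rewrite mulr_sumr; apply: eq_bigr => l _.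
  by rewrite /f; ring.
have i4 i j k l : L1 (f i j k l) by apply: L1Zl; exact: L1_mul4.
have i3 i j k : L1 (fun w => \sum_l f i j k l w) by exact: L1_sum.
have i2 i j : L1 (fun w => \sum_k \sum_l f i j k l w) by exact: L1_sum.
have i1 i : L1 (fun w => \sum_j \sum_k \sum_l f i j k l w) by exact: L1_sum.
rewrite fE; split; first exact: L1_sum.
rewrite expectation_sumE//.
transitivity (\sum_i \sum_j B i j * (\sum_k \sum_l B' k l * mom4 i j k l)).
  apply: eq_bigr => i _; rewrite expectation_sumE//; apply: eq_bigr => j _.
  rewrite expectation_sumE// mulr_sumr; apply: eq_bigr => k _.
  rewrite expectation_sumE// mulr_sumr; apply: eq_bigr => l _.
  by rewrite RintegralZl ?mulrA//; exact: L1_mul4.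
rewrite mulr_suml !mulr_sumr -!big_split/=; apply: eq_bigr => i _.
under eq_bigr do rewrite sum_mom4 (symB' _ i).
transitivity (\sum_j ((\sum_k B' k k) * (B i j * (i == j)%:R) + 2 * (B i j * B' i j) +
   (kappa - 3) * (B i j * B' j j * (i == j)%:R))).
  by apply: eq_bigr => j _; ring.
by rewrite !big_split/= -!mulr_sumr !sum_delta; ring.
Qed.

(** The product of the traces in [quad_expectationM] is the product of the
    means. *)
Lemma quad_covariance (B B' : I -> I -> R) :
    (forall i j, B' i j = B' j i) ->
  covariance P (quad Z B) (quad Z B') =
  (2 * (\sum_i \sum_j B i j * B' i j) +
   (kappa - 3) * (\sum_i B i i * B' i i))%:E.
Proof.
move=> symB'; have [iB EB] := quad_expectation indep_Z L1_Z2 EZ1 EZ2 B.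
have [iB' EB'] := quad_expectation indep_Z L1_Z2 EZ1 EZ2 B'.
have [iBB EBB] := quad_expectationM B symB'.
rewrite covarianceE; [|exact/Lfun1_integrable..].
rewrite !expectationRE// EB EB' [X in X%:E]EBB -EFinM -EFinB; congr (_%:E); ring.
Qed.

End fourth_moments.

(** * The covariance operator of the outer product *)

Section symmetric_matrices.
Context {R : realType}.

Lemma sym_tr k (A : sym R k) : (vsval A)^T = vsval A.
Proof. by apply/eqP; rewrite -mem_sym_space subvsP. Qed.

Lemma sym_dotP k a (A B C : sym R k) :
  sym_dot (a *: A + B) C = a * sym_dot A C + sym_dot B C.
Proof. by rewrite /sym_dot linearP/= mulmxDl -scalemxAl linearP. Qed.

Lemma sym_dotC k (A B : sym R k) : sym_dot A B = sym_dot B A.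
Proof. exact: mxtrace_mulC. Qed.

Lemma sym_dotE k (A B : sym R k) :
  sym_dot A B = \sum_i \sum_j vsval A i j * vsval B i j.
Proof.
apply: eq_bigr => i _; rewrite mxE; apply: eq_bigr => j _.
by rewrite -[in vsval B j i](sym_tr B) mxE.
Qed.

Lemma sym_dot_gt0 k (A : sym R k) : A != 0 -> 0 < sym_dot A A.
Proof.
move=> A0; rewrite sym_dotE lt_def; apply/andP; split; last first.
  by apply: sumr_ge0 => i _; apply: sumr_ge0 => j _; rewrite -expr2 sqr_ge0.
apply: contra A0 => /eqP S0; apply/eqP/val_inj/matrixP => i j /=.
have r0 i' : 0 <= \sum_j' vsval A i' j' * vsval A i' j'.
  by apply: sumr_ge0 => j' _; rewrite -expr2 sqr_ge0.
have /eqP := psumr_eq0P (fun i' _ => r0 i') S0 (i := i) isT.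
rewrite psumr_eq0; last by move=> j' _; rewrite -expr2 sqr_ge0.
by move=> /allP/(_ j (mem_index_enum _)); rewrite mulf_eq0 orbb mxE => /eqP.
Qed.

Lemma dim_sym_gt0 k : (0 < \dim {:sym R k.+1})%N.
Proof.
rewrite lt0n dimv_eq0; apply/eqP => f0.
have : outer_sym (const_mx 1 : 'cV[R]_k.+1) \in {:sym R k.+1}%VS by rewrite memvf.
rewrite f0 memv0 => /eqP/(congr1 vsval)/matrixP/(_ 0 0).
by rewrite !mxE big_ord1 !mxE mulr1 => /eqP; rewrite oner_eq0.
Qed.

End symmetric_matrices.

Section covariance_operator_theory.
Context d (T : measurableType d) {R : realType} (P : probability T R).

(** This holds for every W: the operator either represents the covariance,
    which is symmetric, or is the conventional value 0. *)
Lemma covariance_operator_self k (W : T -> sym R k) (A B : sym R k) :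
  sym_dot A (covariance_operator P W B) = sym_dot B (covariance_operator P W A).
Proof.
rewrite /covariance_operator; case: xgetP => [K _ KP|_].
  by apply: EFin_inj; rewrite !KP covarianceC.
by rewrite !zero_lfunE !(sym_dotC _ 0) !sym_dotE !big1 // => i _; rewrite big1 // => j _; rewrite mxE mul0r.
Qed.

Context p (Z : 'I_p -> {RV P >-> R}) k (U : 'M[R]_(k, p)).

Definition pullback (A : 'M[R]_k) : 'M[R]_p := U^T *m A *m U.

Lemma sym_dot_outer (A : sym R k) (w : T) :
  sym_dot A (outer_sym (U *m (\col_i Z i w))) = quad Z (pullback (vsval A)) w.
Proof.
set z := \col_i Z i w.
transitivity (\tr (pullback (vsval A) *m (z *m z^T))).
  by rewrite /sym_dot /= trmx_mul !mulmxA mxtrace_mulC !mulmxA.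
apply: eq_bigr => i _.
rewrite mxE; apply: eq_bigr => j _.
rewrite [X in _ * X]mxE big_ord1 [z^T _ _]mxE ![z _ _]mxE.
by rewrite [Z j w * _]mulrC.
Qed.

Lemma pullback_sym (A : sym R k) i j :
  pullback (vsval A) i j = pullback (vsval A) j i.
Proof.
suff {1}<- : (pullback (vsval A))^T = pullback (vsval A) by rewrite mxE.
by rewrite !trmx_mul trmxK sym_tr mulmxA.
Qed.

Hypothesis UU : U *m U^T = 1%:M.

(** Pulling back along a matrix with orthonormal rows is an isometry. *)
Lemma pullback_dot (A B : sym R k) :
  \sum_i \sum_j pullback (vsval A) i j * pullback (vsval B) i j = sym_dot A B.
Proof.
transitivity (\tr (pullback (vsval A) *m pullback (vsval B))).
  apply: eq_bigr => i _; rewrite mxE; apply: eq_bigr => j _.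
  by rewrite (pullback_sym B).
rewrite /pullback /sym_dot -!mulmxA [U *m (U^T *m _)]mulmxA UU mul1mx.
by rewrite mxtrace_mulC -!mulmxA UU mulmx1.
Qed.

Variable c : R.

Definition diag_part (B : 'M[R]_p) : 'M[R]_p := diag_mx (\row_i B i i).

(** The operator that represents the bilinear form of [quad_covariance]
    pulled back along U, with c the excess of the fourth moment over 3. *)
Definition model_operator_mx (A : 'M[R]_k) : 'M[R]_k :=
  2 *: A + c *: (U *m diag_part (pullback A) *m U^T).

Lemma model_operator_mx_linear : linear model_operator_mx.
Proof.
move=> a A B; rewrite /model_operator_mx.
have -> : diag_part (pullback (a *: A + B)) =
    a *: diag_part (pullback A) + diag_part (pullback B).
  rewrite /diag_part /pullback mulmxDr mulmxDl -scalemxAr -scalemxAl.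
  by rewrite -linearP; congr diag_mx; apply/rowP => i; rewrite !mxE.
rewrite mulmxDr mulmxDl -scalemxAr -scalemxAl !scalerDr !scalerA.
by rewrite addrACA (mulrC 2) (mulrC c).
Qed.

(** The projection only serves to recover a symmetric matrix as an element
    of the subspace; see [model_operatorE]. *)
Definition model_operator_fun (A : sym R k) : sym R k :=
  vsproj (sym_space k) (model_operator_mx (vsval A)).

Lemma model_operator_fun_linear : linear model_operator_fun.
Proof.
move=> a A B; rewrite /model_operator_fun.
by rewrite [vsval (a *: A + B)]linearP model_operator_mx_linear linearP.
Qed.

HB.instance Definition _ :=
  GRing.isLinear.Build R (sym R k) (sym R k) *:%R model_operator_fun
    model_operator_fun_linear.

Definition model_operator : 'End(sym R k) := linfun model_operator_fun.

Lemma model_operatorE (A : sym R k) :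
  vsval (model_operator A) = model_operator_mx (vsval A).
Proof.
rewrite lfunE/= vsprojK// mem_sym_space /model_operator_mx.
by rewrite linearD/= !linearZ/= sym_tr !trmx_mul trmxK tr_diag_mx mulmxA.
Qed.

Lemma sym_dot_model_operator (A B : sym R k) :
  sym_dot A (model_operator B) = 2 * sym_dot A B +
    c * \sum_i pullback (vsval A) i i * pullback (vsval B) i i.
Proof.
rewrite {1}/sym_dot model_operatorE mulmxDr -!scalemxAr linearD/= !linearZ/=.
congr (_ + _ * _).
rewrite !mulmxA mxtrace_mulC !mulmxA -/(pullback _).
apply: eq_bigr => i _; rewrite mul_mx_diag !mxE//.
Qed.

End covariance_operator_theory.

Section score_spectrum.
Context d (T : measurableType d) {R : realType} (P : probability T R).
Local Notation L1 f := (P.-integrable setT (EFin \o f)).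
Local Notation "\E f" := (\int[P]_w f w)%R (at level 10, f at level 9).
Context p (Z : 'I_p -> {RV P >-> R}) (kappa : R).
Hypothesis indep_Z : mutually_independent P Z.
Hypothesis L1_Z4 : forall i, L1 (fun w => Z i w ^+ 4).
Hypothesis EZ1 : forall i, \E (Z i) = 0.
Hypothesis EZ2 : forall i, \E (fun w => Z i w ^+ 2) = 1.
Hypothesis EZ4 : forall i, \E (fun w => Z i w ^+ 4) = kappa.
Context k (U : 'M[R]_(k, p)).
Hypothesis UU : U *m U^T = 1%:M.

Let W (w : T) : sym R k := outer_sym (U *m (\col_i Z i w)).

Let W_covariance (A B : sym R k) :
  covariance P (fun w => sym_dot A (W w)) (fun w => sym_dot B (W w)) =
  (2 * sym_dot A B + (kappa - 3) *
     \sum_i pullback U (vsval A) i i * pullback U (vsval B) i i)%:E.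
Proof.
have dE C : (fun w => sym_dot C (W w)) = quad Z (pullback U (vsval C)).
  by apply/funext => w; exact: sym_dot_outer.
rewrite !dE (quad_covariance indep_Z L1_Z4 EZ1 EZ2 EZ4).
  by rewrite pullback_dot.
by move=> i j; exact: pullback_sym.
Qed.

(** If K A = a A, then a <A, A> = 2 <A, A> + (kappa - 3) D, where D is the sum
    of squares of the diagonal of U^T A U and so 0 <= D <= <A, A>. *)
Lemma covariance_operator_eigenvalue a :
  passmx.leigenvalue (covariance_operator P W) a ->
  Num.min 2 (kappa - 1) <= a <= Num.max 2 (kappa - 1).
Proof.
(* [model_operator] shows that a covariance operator exists. *)
have KP : is_covariance_operator P W (covariance_operator P W).
  apply: xgetPex; exists (model_operator U (kappa - 3)) => A B.
  by rewrite sym_dot_model_operator W_covariance.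
move=> /leigenvalueP[A A0 KA].
have A_gt0 := sym_dot_gt0 A0.
have := KP A A; rewrite KA W_covariance => -[].
rewrite sym_dotC -[a *: A]addr0 sym_dotP.
have -> : sym_dot 0 A = 0.
  by rewrite sym_dotE big1// => i _; rewrite big1// => j _; rewrite mxE mul0r.
rewrite addr0; set D := \sum_i _ => aE.
have D0 : 0 <= D by apply: sumr_ge0 => i _; rewrite -expr2 sqr_ge0.
have DA : D <= sym_dot A A.
  rewrite -(pullback_dot UU); apply: ler_sum => i _.
  rewrite (bigD1 i)//= lerDl; apply: sumr_ge0 => j _.
  by rewrite -expr2 sqr_ge0.
rewrite ge_min le_max; set x := sym_dot A A in A_gt0 aE DA *.
have [k3|/ltW k3] := leP (kappa - 3) 0; apply/andP; split; apply/orP.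
- right; rewrite -(ler_pM2r A_gt0) aE; nra.
- left; rewrite -(ler_pM2r A_gt0) aE; nra.
- left; rewrite -(ler_pM2r A_gt0) aE; nra.
- right; rewrite -(ler_pM2r A_gt0) aE; nra.
Qed.

End score_spectrum.

(** * Moments of standardized variables *)

Section identical_distribution.
Context d (T : measurableType d) {R : realType} (P : probability T R).
Local Notation L1 f := (P.-integrable setT (EFin \o f)).
Local Notation "\E f" := (\int[P]_w f w)%R (at level 10, f at level 9).
Context (I : Type) (Z : I -> {RV P >-> R}).
Hypothesis ident_Z : identically_distributed Z.

Lemma ge0_integral_ident i j (h : R -> \bar R) :
    measurable_fun setT h -> (forall x, 0 <= h x)%E ->
  (\int[P]_w h (Z i w) = \int[P]_w h (Z j w))%E.
Proof.
move=> mh h0.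
rewrite -[LHS](ge0_integral_distribution (Z i) mh h0).
rewrite -[RHS](ge0_integral_distribution (Z j) mh h0).
by apply: eq_measure_integral => A mA _; exact: ident_Z.
Qed.

Lemma L1_ident i j (h : R -> R) : measurable_fun setT h ->
  L1 (fun w => h (Z i w)) -> L1 (fun w => h (Z j w)).
Proof.
move=> mh /integrableP[_ hi]; apply/integrableP; split.
  by apply/measurable_EFinP; exact: measurableT_comp.
rewrite -(@ge0_integral_ident i j (fun x => `|(h x)%:E|)%E)//.
by apply/measurable_EFinP; exact: measurableT_comp.
Qed.

Lemma expectation_ident i j (h : R -> R) : measurable_fun setT h ->
  \E (fun w => h (Z i w)) = \E (fun w => h (Z j w)).
Proof.
move=> mh; congr fine.
have hE k : (\int[P]_w (h (Z k w))%:E =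
    \int[P]_w ((EFin \o h)^\+ (Z k w)) - \int[P]_w ((EFin \o h)^\- (Z k w)))%E.
  have := integralE P setT ((EFin \o h) \o Z k).
  by rewrite funepos_comp funeneg_comp.
rewrite !hE; congr (_ - _)%E.
- apply: (@ge0_integral_ident i j _) => //.
  by apply: measurable_funepos; exact/measurable_EFinP.
- apply: (@ge0_integral_ident i j _) => //.
  by apply: measurable_funeneg; exact/measurable_EFinP.
Qed.

Lemma Lq_norm_ident q i j : q != 0 ->
  Lq_norm P q (Z i) = Lq_norm P q (Z j).
Proof.
move=> q0.
have E k : (Lq_norm P q (Z k) = (\int[P]_w (`|Z k w| `^ q)%:E) `^ q^-1)%E.
  exact: Lq_normE.
apply: (etrans (E i)); apply: (etrans _ (esym (E j))).
apply: (congr1 (fun x => x `^ q^-1)%E).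
apply: (ge0_integral_ident i j (h := fun x => (`|x| `^ q)%:E)).
  by apply/measurable_EFinP; exact: (measurableT_comp (measurable_powR q)).
by move=> x; rewrite lee_fin powR_ge0.
Qed.

Lemma Lq_growth_ident nu i j : Lq_growth P nu (Z i) = Lq_growth P nu (Z j).
Proof.
rewrite /Lq_growth; congr ereal_sup; apply: eq_imagel => q q2.
congr (_ * _)%E; apply: Lq_norm_ident.
by rewrite gt_eqF// (lt_le_trans _ q2).
Qed.

End identical_distribution.

Section standardized.
Context d (T : measurableType d) {R : realType} (P : probability T R).
Local Notation L1 f := (P.-integrable setT (EFin \o f)).
Local Notation "\E f" := (\int[P]_w f w)%R (at level 10, f at level 9).
Implicit Types f : T -> R.

Lemma L1_of_ge0_integral f (v : R) : measurable_fun setT f ->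
  (forall w, 0 <= f w) -> (\int[P]_w (f w)%:E = v%:E)%E ->
  L1 f /\ \E f = v.
Proof.
move=> mf f0 fv; split; last by rewrite /Rintegral fv.
apply/integrableP; split; first exact/measurable_EFinP.
by under eq_integral do rewrite /= ger0_norm//; rewrite fv ltry.
Qed.

Lemma variance_second_moment f (m v : R) : measurable_fun setT f ->
    ('E_P[f] = m%:E)%E -> ('V_P[f] = v%:E)%E ->
  L1 (fun w => (f w - m) ^+ 2) /\ \E (fun w => (f w - m) ^+ 2) = v.
Proof.
move=> mf Ef Vf; apply: L1_of_ge0_integral.
- by apply: measurable_funX; exact: measurable_funB.
- by move=> w; exact: sqr_ge0.
- move: Vf; rewrite /variance unlock Ef/= unlock => <-.
  by apply: eq_integral => w _; rewrite expr2.
Qed.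

Lemma standardized_moments (f : T -> R) : measurable_fun setT f ->
    ('E_P[f] = 0)%E -> ('V_P[f] = 1)%E ->
  [/\ L1 (fun w => f w ^+ 2), \E f = 0 & \E (fun w => f w ^+ 2) = 1].
Proof.
move=> mf Ef Vf.
have [i2 E2] := variance_second_moment mf Ef Vf.
have fE : (fun w => (f w - 0) ^+ 2) = (fun w => f w ^+ 2).
  by apply/funext => w; rewrite subr0.
rewrite fE in i2 E2; split => //.
by move: Ef; rewrite unlock /Rintegral => ->.
Qed.

(** f^4 is recovered from (f^2 - 1)^2, whose integral is the variance of f^2. *)
Lemma standardized_fourth_moment (f : T -> R) (v : R) :
    measurable_fun setT f -> L1 (fun w => f w ^+ 2) ->
    \E (fun w => f w ^+ 2) = 1 ->
    ('V_P[(fun w => f w ^+ 2)%R] = v%:E)%E ->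
  L1 (fun w => f w ^+ 4) /\ \E (fun w => f w ^+ 4) = v + 1.
Proof.
move=> mf i2 E2 Vf.
have Ef2 : ('E_P[(fun w => f w ^+ 2)%R] = 1%:E)%E.
  by rewrite unlock -E2 /Rintegral fineK//; exact: integrable_fin_num.
have [iv Ev] := variance_second_moment (measurable_funX 2 mf) Ef2 Vf.
have f4E : (fun w => f w ^+ 4) =
    (fun w => (f w ^+ 2 - 1) ^+ 2 + (2 * f w ^+ 2 + (- 1))).
  by apply/funext => w; ring.
have i21 : L1 (fun w => 2 * f w ^+ 2 + (- 1)).
  by apply: L1D; [exact: L1Zl|exact: L1_cst].
rewrite f4E; split; first exact: L1D.
rewrite RintegralD// Ev RintegralD//; [|exact: L1Zl|exact: L1_cst].
by rewrite RintegralZl// E2 expectation_cst1; lra.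
Qed.

End standardized.

(** * The scores as orthonormal linear forms *)

Section model.
Context d (T : measurableType d) {R : realType} (P : probability T R).
Local Notation L1 f := (P.-integrable setT (EFin \o f)).
Local Notation "\E f" := (\int[P]_w f w)%R (at level 10, f at level 9).
Context p (Z : 'I_p -> {RV P >-> R}).
Hypothesis indep_Z : mutually_independent P Z.
Hypothesis L1_Z2 : forall i, L1 (fun w => Z i w ^+ 2).
Hypothesis EZ1 : forall i, \E (Z i) = 0.
Hypothesis EZ2 : forall i, \E (fun w => Z i w ^+ 2) = 1.
Variable M : 'M[R]_p.

Lemma covariance_MP_vector :
  covariance_matrix P (MP_vector M Z) = M *m M^T.
Proof.
apply/matrixP => i j; rewrite !mxE.
have XE l : (fun w => MP_vector M Z w l 0) = lin Z (M l).
  by apply/funext => w; rewrite !mxE; apply: eq_bigr => k _; rewrite mxE.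
rewrite !XE (lin_covariance indep_Z L1_Z2 EZ1 EZ2)/=.
by apply: eq_bigr => k _; rewrite mxE.
Qed.

Lemma Lq_norm2_lin (a : 'I_p -> R) :
  Lq_norm P 2 (lin Z a) = (Num.sqrt (\sum_i a i ^+ 2))%:E.
Proof.
have [iaa Eaa] := lin_expectationM indep_Z L1_Z2 EZ1 EZ2 a a.
rewrite Lq_normE//.
have -> : (\int[P]_w (`|lin Z a w| `^ 2)%:E = (\sum_i a i ^+ 2)%:E)%E.
  transitivity (\int[P]_w (lin Z a w * lin Z a w)%:E)%E.
    apply: eq_integral => w _.
    by rewrite powR_mulrn// real_normK ?num_real// expr2.
  rewrite -[LHS]fineK; last exact: integrable_fin_num.
  congr (_%:E); rewrite -[LHS]/(Rintegral _ _ _) Eaa.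
  by apply: eq_bigr => i _; rewrite expr2.
rewrite poweR_EFin powR12_sqrt// sumr_ge0// => i _; exact: sqr_ge0.
Qed.

(** The vectors s_j = M^T phi_j satisfy <s_i, s_j> = phi_i^T Sigma phi_j, which
    is lam_j when i = j and 0 otherwise; and lam_j > 0 as Sigma is positive
    definite. *)
Lemma normalized_score_orthonormal (Sigma : 'M[R]_p)
    (lam : 'I_p -> R) (phi : 'I_p -> 'cV[R]_p) :
    Sigma = covariance_matrix P (MP_vector M Z) -> pdmx Sigma ->
    spectral_decomposition Sigma lam phi ->
  exists2 U : 'M[R]_p, U *m U^T = 1%:M &
    forall j, normalized_score P (MP_vector M Z) phi j = lin Z (U j).
Proof.
move=> SigmaE [_ pd] [Sspec _ ortho].
pose s j i := (M^T *m phi j) i 0.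
have scoreE j : (fun w => dotp (MP_vector M Z w) (phi j)) = lin Z (s j).
  apply/funext => w; rewrite /dotp trmx_mul -mulmxA !mxE.
  by apply: eq_bigr => i _; rewrite [X in X * _]mxE [X in X * _]mxE mulrC.
have Sphi j : Sigma *m phi j = lam j *: phi j.
  rewrite Sspec mulmx_suml (bigD1 j)//= big1 ?addr0.
    rewrite -scalemxAl -mulmxA [_^T *m _]mx11_scalar -[_ 0 0]/(dotp _ _) ortho eqxx.
    by rewrite mulmx1.
  move=> i ij.
  rewrite -scalemxAl -mulmxA [_^T *m _]mx11_scalar -[_ 0 0]/(dotp _ _) ortho.
  by rewrite (negbTE ij) raddf0 mulmx0 scaler0.
have ss i j : \sum_k s i k * s j k = lam j * (i == j)%:R.
  rewrite -ortho.
  transitivity (dotp (phi i) (Sigma *m phi j)); last first.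
    by rewrite Sphi /dotp -scalemxAr mxE.
  rewrite SigmaE covariance_MP_vector /dotp -mulmxA mulmxA.
  have -> : (phi i)^T *m M = (M^T *m phi i)^T by rewrite trmx_mul trmxK.
  by rewrite [RHS]mxE; apply: eq_bigr => k _; rewrite [in RHS]mxE.
have lam0 j : 0 < lam j.
  have phi0 : phi j != 0.
    apply/eqP => phi0; have := ortho j j; rewrite phi0 /dotp mulmx0 mxE eqxx.
    by move/eqP; rewrite eq_sym oner_eq0.
  by have := pd _ phi0; rewrite Sphi /dotp -scalemxAr mxE -/(dotp _ _) ortho eqxx mulr1.
pose U : 'M[R]_p := \matrix_(j, i) (s j i / Num.sqrt (lam j)).
exists U.
  apply/matrixP => i j; rewrite !mxE.
  transitivity (\sum_k (Num.sqrt (lam i))^-1 * (Num.sqrt (lam j))^-1 * (s i k * s j k)).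
    by apply: eq_bigr => k _; rewrite !mxE; ring.
  rewrite -mulr_sumr ss; have [<-|] := eqVneq i j; last by rewrite !mulr0.
  rewrite mulr1 -invfM -expr2 sqr_sqrtr ?ltW// mulVf// gt_eqF//.
move=> j; apply/funext => w; rewrite /normalized_score scoreE Lq_norm2_lin/=.
have -> : \sum_i s j i ^+ 2 = lam j.
  have := ss j j; rewrite eqxx mulr1 => <-.
  by apply: eq_bigr => i _; rewrite expr2.
have -> : dotp (MP_vector M Z w) (phi j) = lin Z (s j) w by rewrite -scoreE.
by rewrite /lin mulr_suml; apply: eq_bigr => i _; rewrite mxE; ring.
Qed.

End model.

(** * The two claims *)

Section one_model.
Context d (T : measurableType d) {R : realType} (P : probability T R).
Local Notation L1 f := (P.-integrable setT (EFin \o f)).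
Local Notation "\E f" := (\int[P]_w f w)%R (at level 10, f at level 9).
Context p (Z : 'I_p -> {RV P >-> R}) (zeta : 'I_p -> T -> R) (U : 'M[R]_p).
Hypothesis zetaE : forall j, zeta j = lin Z (U j).
Hypothesis UU : U *m U^T = 1%:M.

Lemma leading_scoresE (e : 'I_p) (w : T) :
  leading_scores zeta e w =
  rowsub (widen_ord (ltn_ord e)) U *m (\col_i Z i w).
Proof.
apply/colP => i; rewrite !mxE zetaE; apply: eq_bigr => j _.
by rewrite !mxE.
Qed.

Lemma rowsub_orthonormal (e : 'I_p) :
  rowsub (widen_ord (ltn_ord e)) U *m (rowsub (widen_ord (ltn_ord e)) U)^T = 1%:M.
Proof.
apply/matrixP => i j.
have /matrixP/(_ (widen_ord (ltn_ord e) i) (widen_ord (ltn_ord e) j)) := UU.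
by rewrite !mxE => <-; apply: eq_bigr => k _; rewrite !mxE.
Qed.

(** The operator is self-adjoint whatever the moments of Z are; hence this
    inequality for every model of the sequence, not only for large n. *)
Lemma lambda_min_le_max_score (e : 'I_p) :
  lambda_min (score_operator P zeta e) <= lambda_max (score_operator P zeta e).
Proof.
apply: (@lambda_min_le_max _ _ (@sym_dot R e.+1)).
- exact: sym_dotP.
- exact: sym_dotC.
- exact: sym_dot_gt0.
- exact: dim_sym_gt0.
- exact: covariance_operator_self.
Qed.

Variable v : R.
Hypothesis indep_Z : mutually_independent P Z.
Hypothesis L1_Z4 : forall i, L1 (fun w => Z i w ^+ 4).
Hypothesis EZ1 : forall i, \E (Z i) = 0.
Hypothesis EZ2 : forall i, \E (fun w => Z i w ^+ 2) = 1.
Hypothesis EZ4 : forall i, \E (fun w => Z i w ^+ 4) = v + 1.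

Lemma score_operator_eigenvalue (e : 'I_p) a :
  passmx.leigenvalue (score_operator P zeta e) a ->
  Num.min 2 v <= a <= Num.max 2 v.
Proof.
rewrite /score_operator; under eq_fun do rewrite leading_scoresE.
move/(covariance_operator_eigenvalue indep_Z L1_Z4 EZ1 EZ2 EZ4 (rowsub_orthonormal e)).
by rewrite addrK.
Qed.

Lemma score_lambda_bounds (e : 'I_p) :
  Num.min 2 v <= lambda_min (score_operator P zeta e) /\
  lambda_max (score_operator P zeta e) <= Num.max 2 v.
Proof.
have self := covariance_operator_self P (fun w => outer_sym (leading_scores zeta e w)).
split.
- apply: (lambda_min_ge (@sym_dotP R _) (@sym_dotC R _) (@sym_dot_gt0 R _)
    (@dim_sym_gt0 R _) self) => a /score_operator_eigenvalue /andP[]//.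
- apply: (lambda_max_le (@sym_dotP R _) (@sym_dotC R _) (@sym_dot_gt0 R _)
    (@dim_sym_gt0 R _) self) => a /score_operator_eigenvalue /andP[]//.
Qed.

End one_model.

Theorem proposition3p2 (R : realType)
  (disp : nat -> measure_display)
  (T : forall n, measurableType (disp n))
  (P : forall n, probability (T n) R)
  (p : nat -> nat) (p_gt0 : forall n, (0 < p n)%N)
  (M : forall n, 'M[R]_(p n))
  (Z : forall n, 'I_(p n) -> {RV (P n) >-> R})
  (Z1 : forall n, T n -> R)
  (Z1_first : forall n, Z1 n = Z n (Ordinal (p_gt0 n)))
  (M_psd : forall n, psdmx (M n))
  (Z_indep : forall n, mutually_independent (P n) (fun i => Z n i : T n -> R))
  (Z_ident : forall n, identically_distributed (Z n))
  (Z_mean : forall n, ('E_(P n)[Z1 n] = 0)%E)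
  (Z_var : forall n, ('V_(P n)[Z1 n] = 1)%E)
  (X : forall n, T n -> 'cV[R]_(p n))
  (X_def : forall n, X n = MP_vector (M n) (Z n))
  (Sigma : forall n, 'M[R]_(p n))
  (Sigma_def : forall n, Sigma n = covariance_matrix (P n) (X n))
  (Sigma_pd : forall n, pdmx (Sigma n))
  (lam : forall n, 'I_(p n) -> R)
  (phi : forall n, 'I_(p n) -> 'cV[R]_(p n))
  (Sigma_spec : forall n, spectral_decomposition (Sigma n) (@lam n) (@phi n))
  (zeta : forall n, 'I_(p n) -> T n -> R)
  (zeta_def : forall n j, @zeta n j = normalized_score (P n) (X n) (@phi n) j) :
  (forall nu : R, 0 < nu ->
     lesssim (fun n => Lq_growth (P n) nu (Z1 n)) (fun=> 1%E) ->
     exists2 nu' : R, 0 < nu' &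
       lesssim
         (fun n => ereal_sup [set Lq_growth (P n) nu' (@zeta n j) | j in [set: 'I_(p n)]])
         (fun=> 1%E))
  /\
  (asymp (fun n => 'V_(P n)[(fun w => (Z1 n w ^+ 2)%R)]%E) (fun=> 1%E) ->
   let inf_min n :=
     ereal_inf [set (lambda_min (score_operator (P n) (@zeta n) d))%:E
               | d in [set: 'I_(p n)]] in
   let sup_max n :=
     ereal_sup [set (lambda_max (score_operator (P n) (@zeta n) d))%:E
               | d in [set: 'I_(p n)]] in
   [/\ lesssim (fun=> 1%E) inf_min,
       forall n, (inf_min n <= sup_max n)%E &
       lesssim sup_max (fun=> 1%E)]).
Proof.
have mX (r : nat) : measurable_fun setT (fun x : R => x ^+ r) by exact: measurable_funX.
have momZ n := standardized_moments
  (f := Z1 n) (eq_ind_r _ (measurable_funPT (Z n (Ordinal (p_gt0 n)))) (Z1_first n))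
  (Z_mean n) (Z_var n).
have L1_Z2 n i : (P n).-integrable setT (EFin \o (fun w => Z n i w ^+ 2)).
  have [i2 _ _] := momZ n; rewrite Z1_first in i2.
  exact: (L1_ident (Z_ident n) i (mX 2) i2).
have EZ1 n i : \int[P n]_w Z n i w = 0.
  have [_ E1 _] := momZ n; rewrite Z1_first in E1.
  by rewrite -E1; exact: (expectation_ident (Z_ident n) i (Ordinal (p_gt0 n)) (@measurable_id _ R setT)).
have EZ2 n i : \int[P n]_w (Z n i w ^+ 2) = 1.
  have [_ _ E2] := momZ n; rewrite Z1_first in E2.
  by rewrite -E2; exact: (expectation_ident (Z_ident n) i (Ordinal (p_gt0 n)) (mX 2)).
have zetaE n : exists2 U : 'M[R]_(p n), U *m U^T = 1%:M &
    forall j, @zeta n j = lin (Z n) (U j).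
  have [|U UU UZ] := normalized_score_orthonormal (Z_indep n) (L1_Z2 n) (EZ1 n) (EZ2 n)
    (M := M n) _ (Sigma_pd n) (Sigma_spec n).
    by rewrite Sigma_def X_def.
  by exists U => // j; rewrite zeta_def X_def UZ.
split.
  (* nu + 1/2 is the exponent of [Lq_growth_linear_form]. *)
  move=> nu nu0 [c c0 Z1c]; exists (nu + 2^-1); first by lra.
  exists (6 * 2 `^ nu * c); first by rewrite !mulr_gt0// powR_gt0.
  near=> n; rewrite mule1; apply: ub_ereal_sup => _ [j _ <-].
  have [U UU ->] := zetaE n.
  apply: (Lq_growth_linear_form (Z_indep n) (EZ1 n)) => //.
    transitivity ((U *m U^T) j j); last by rewrite UU mxE eqxx.
    by rewrite mxE; apply: eq_bigr => i _; rewrite mxE expr2.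
  move=> i; rewrite (Lq_growth_ident (Z_ident n) nu i (Ordinal (p_gt0 n))) -Z1_first.
  by rewrite -[leRHS]mule1; near: n.
move=> [[c1 c10 Vc1] [c2 c20 Vc2]] inf_min sup_max.
(* Under the two asymptotic bounds the variance of Z_11^2 is a real number v,
   comparable to 1, and the fourth moments are finite. *)
have fourth n : ('V_(P n)[(fun w => (Z1 n w ^+ 2)%R)] <= c1%:E * 1)%E ->
    (1 <= c2%:E * 'V_(P n)[(fun w => (Z1 n w ^+ 2)%R)])%E ->
    exists2 v : R, v <= c1 /\ 1 <= c2 * v & forall e : 'I_(p n),
      Num.min 2 v <= lambda_min (score_operator (P n) (@zeta n) e) /\
      lambda_max (score_operator (P n) (@zeta n) e) <= Num.max 2 v.
  rewrite mule1; set V := 'V_(P n)[_]%E => Vle Vge.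
  have V0 : (0 <= V)%E by exact: variance_ge0.
  have [v Vv] : exists v : R, V = v%:E.
    by exists (fine V); rewrite fineK// ge0_fin_numE// (le_lt_trans Vle)// ltry.
  exists v.
    by move: Vle Vge; rewrite Vv -EFinM !lee_fin.
  have [U UU UZ] := zetaE n.
  have [i2 _ E2] := momZ n.
  have mZ1 : measurable_fun setT (Z1 n) by rewrite Z1_first.
  have [i4 E4] := standardized_fourth_moment mZ1 i2 E2 Vv.
  rewrite Z1_first in i4 E4.
  apply: (score_lambda_bounds UZ UU (Z_indep n) _ (EZ1 n) (EZ2 n)) => i.
    exact: (L1_ident (Z_ident n) i (mX 4) i4).
  by rewrite -E4; exact: (expectation_ident (Z_ident n) i (Ordinal (p_gt0 n)) (mX 4)).
split.
- (* v >= 1 / c2, so every eigenvalue is at least m. *)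
  pose m := Num.min 2 c2^-1.
  have m0 : 0 < m by rewrite lt_min invr_gt0 c20 andbT.
  exists m^-1; first by rewrite invr_gt0.
  near=> n.
  have [||v [_ v2] bounds] := fourth n; [by near: n|by near: n|].
  have mv : m <= Num.min 2 v.
    rewrite le_min !ge_min lexx/=; apply/orP; right.
    by rewrite -[c2^-1]mul1r ler_pdivrMr// mulrC.
  rewrite -(@lee_pmul2l _ m%:E)// ?lte_fin// mule1 muleA -EFinM divff ?gt_eqF// mul1e.
  apply/ereal_infP => _ [e _ <-]; rewrite lee_fin.
  exact: le_trans mv (bounds e).1.
- move=> n; pose e : 'I_(p n) := Ordinal (p_gt0 n).
  apply: (@le_trans _ _ (lambda_min (score_operator (P n) (@zeta n) e))%:E).
    by apply: ereal_inf_lbound; exists e.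
  apply: (@le_trans _ _ (lambda_max (score_operator (P n) (@zeta n) e))%:E).
    by rewrite lee_fin; exact: lambda_min_le_max_score.
  by apply: ereal_sup_ubound; exists e.
- exists (Num.max 2 c1); first by rewrite lt_max ltr0n.
  near=> n; rewrite mule1.
  have [||v [v1 _] bounds] := fourth n; [by near: n|by near: n|].
  apply: ub_ereal_sup => _ [e _ <-]; rewrite lee_fin.
  apply: (le_trans (bounds e).2).
  by rewrite ge_max !le_max lexx v1 orbT.
Unshelve. all: by end_near. Qed.
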